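(* Let $R=[a,b]\times[c,d]$ and $2\le\beta\le3$. Let $f\in\mathcal{C}(R)$ with $f(\boldsymbol{x})\ge0$ for all $\boldsymbol{x}\in R$. Then, for every $\epsilon>0$, there exists $g\in\mathcal{S}_\beta$ such that $$g(\boldsymbol{x})\ge0\ \text{ for all }\boldsymbol{x}\in R\quad\text{and}\quad\|f-g\|_\infty<\epsilon.$$
   Context: $a<b$ and $c<d$ are real numbers. $\mathcal{C}(R)$ is the space of continuous functions $R\to\mathbb{R}$ with supremum norm $\|\cdot\|_\infty$. $\mathcal{S}_\beta:=\{g\in\mathcal{C}(R):\dim(Gr(g))=\beta\}$, where $Gr(g)\subset\mathbb{R}^3$ is the graph of $g$ and $\dim$ is any one (fixed) of the Hausdorff, box or packing dimensions. *)

(* Defs.v *)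
From HB Require Import structures.
From mathcomp Require Export all_boot all_order all_algebra.
From mathcomp Require Export all_classical all_reals all_analysis.
Set Implicit Arguments.
Unset Strict Implicit.
Unset Printing Implicit Defensive.
Export Order.TTheory GRing.Theory Num.Theory numFieldNormedType.Exports.

Local Open Scope classical_set_scope.
Local Open Scope ring_scope.

(** A point of R^3 is a triple ((x, y), z). The canonical distance of the
    library on products is the max distance, hence an explicit Euclidean one. *)
Definition edist3 (R : realType) (p q : R * R * R) : R :=
  Num.sqrt ((p.1.1 - q.1.1) ^+ 2 + (p.1.2 - q.1.2) ^+ 2 + (p.2 - q.2) ^+ 2).

(** [diam3 set0] is [-oo]. *)
Definition diam3 (R : realType) (U : set (R * R * R)) : \bar R :=
  ereal_sup [set (edist3 p q)%:E | p in U & q in U].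

Definition closed_ball3 (R : realType) (p : R * R * R) (r : R) :
  set (R * R * R) := [set q | edist3 p q <= r].

(** |U|^s, with the usual conventions that the empty set contributes 0 and that
    a nonempty set contributes 1 when s = 0. *)
Definition diam_pow (R : realType) (s : R) (U : set (R * R * R)) : \bar R :=
  if U == set0 then 0%E else poweR (diam3 U) s.

Definition delta_cover (R : realType) (delta : R) (A : set (R * R * R))
    (U : nat -> set (R * R * R)) : Prop :=
  A `<=` \bigcup_n U n /\ forall n, (diam3 (U n) <= delta%:E)%E.

Definition hausdorff_content (R : realType) (s delta : R)
    (A : set (R * R * R)) : \bar R :=
  ereal_inf [set (\sum_(n <oo) diam_pow s (U n))%E | U in delta_cover delta A].

(** The supremum is the limit as delta tends to 0+, by monotonicity. *)
Definition hausdorff_measure (R : realType) (s : R) (A : set (R * R * R)) :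
  \bar R :=
  ereal_sup [set hausdorff_content s delta A | delta in [set delta | 0 < delta]].

Definition hausdorff_dim (R : realType) (A : set (R * R * R)) : \bar R :=
  ereal_inf [set s%:E | s in [set s | 0 <= s /\ hausdorff_measure s A = 0%E]].

(** Least number of sets of diameter at most delta that cover A;
    [+oo] if there is no finite such cover. *)
Definition covering_number (R : realType) (delta : R) (A : set (R * R * R)) :
  \bar R :=
  ereal_inf [set (n%:R)%:E | n in [set n : nat |
    exists U : 'I_n -> set (R * R * R),
      A `<=` \bigcup_i U i /\ forall i, (diam3 (U i) <= delta%:E)%E]].

Definition box_ratio (R : realType) (A : set (R * R * R)) (delta : R) : \bar R :=
  (lne (covering_number delta A) * ((- ln delta)^-1)%:E)%E.

Definition lower_box_dim (R : realType) (A : set (R * R * R)) : \bar R :=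
  limf_einf (box_ratio A) (at_right (0 : R)).

Definition upper_box_dim (R : realType) (A : set (R * R * R)) : \bar R :=
  limf_esup (box_ratio A) (at_right (0 : R)).

(** A countable family of pairwise disjoint balls (indexed by a set D of
    naturals) of radii at most delta and centres in A. *)
Definition delta_packing (R : realType) (delta : R) (A : set (R * R * R))
    (D : set nat) (x : nat -> R * R * R) (r : nat -> R) : Prop :=
  (forall n, D n -> A (x n) /\ 0 < r n <= delta) /\
  trivIset D (fun n => closed_ball3 (x n) (r n)).

Definition packing_content (R : realType) (s delta : R) (A : set (R * R * R)) :
  \bar R :=
  ereal_sup [set t | exists D x r, delta_packing delta A D x r /\
    t = (\esum_(n in D) diam_pow s (closed_ball3 (x n) (r n)))%E].

(** The infimum is the limit as delta tends to 0+, by monotonicity. *)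
Definition packing_premeasure (R : realType) (s : R) (A : set (R * R * R)) :
  \bar R :=
  ereal_inf [set packing_content s delta A | delta in [set delta | 0 < delta]].

Definition packing_measure (R : realType) (s : R) (A : set (R * R * R)) :
  \bar R :=
  ereal_inf [set (\sum_(n <oo) packing_premeasure s (F n))%E |
    F in [set F : nat -> set (R * R * R) | A `<=` \bigcup_n F n]].

Definition packing_dim (R : realType) (A : set (R * R * R)) : \bar R :=
  ereal_inf [set s%:E | s in [set s | 0 <= s /\ packing_measure s A = 0%E]].

Inductive dimension := Hausdorff | Box | Packing.

(** The box dimension exists only when the lower and upper ones agree, so
    "dim A = beta" is a relation. *)
Definition has_dim (R : realType) (dim : dimension) (A : set (R * R * R))
    (beta : R) : Prop :=
  match dim with
  | Hausdorff => hausdorff_dim A = beta%:E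
  | Box => lower_box_dim A = beta%:E /\ upper_box_dim A = beta%:E
  | Packing => packing_dim A = beta%:E
  end.

Definition rectangle (R : realType) (a b c d : R) : set (R * R) :=
  `[a, b] `*` `[c, d].

(** Functions on a subset D of the plane are represented by total functions, of
    which only the restriction to D is relevant. *)
Definition cont_on (R : realType) (D : set (R * R)) : set (R * R -> R) :=
  [set g | {within D, continuous g}].

Definition sup_norm (R : realType) (D : set (R * R)) (h : R * R -> R) : R :=
  sup [set `|h x| | x in D].

Definition graph_on (R : realType) (D : set (R * R)) (g : R * R -> R) :
  set (R * R * R) := [set (x, g x) | x in D].

Definition S_dim (R : realType) (dim : dimension) (D : set (R * R)) (beta : R) :
  set (R * R -> R) :=
  [set g | cont_on D g /\ has_dim dim (graph_on D g) beta].

(* Main.v *)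
(** The graph of g = q + eta * z((x - a) / (b - a)) is studied, where q is a
    nonnegative Lipschitz function close to f (an infimal convolution of f) and
    z >= 0 is a continuous function of one variable on [0, 1].  The function z
    is a limit of zigzags: on each cell of level n it runs through one dyadic
    interval of length 2^-n, and a cell is subdivided into 2 p_n cells of level
    n + 1, of which p_n (odd) lie over each half of this dyadic interval.
    Hence, inside a cell, the time spent by z in a dyadic interval is
    proportional to the length of the interval.  When the numbers p_n are chosen
    so that cells of length r have height r^H up to r^o(1), where
    H = 3 - beta, the Lebesgue measure of the square, transported to the graph,
    gives to balls of radius r a mass r^beta, up to r^o(1).  The lower bound on
    the mass of balls bounds from above the number, or the sizes, of disjoint
    balls centred on the graph, and the upper bound is a mass distribution
    principle; together they force all three dimensions to be beta. *)
Require Import Defs.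
From mathcomp Require Import measurable_realfun zify ring lra.
Set Implicit Arguments.
Unset Strict Implicit.
Unset Printing Implicit Defensive.

(** * Combinatorics of the cells *)

Local Open Scope nat_scope.

(** The graph of a merely continuous [f] may itself be too rough, which is why [f] gives way to a
    Lipschitz function before any zigzag is added. The infimal convolution stays between 0 and [f],
    so the sum with a nonnegative zigzag is nonnegative even where [f] vanishes. A Lipschitz term
    moves heights by at most a multiple of the horizontal displacement; balls centred on the graph
    are thus comparable with products of a ball on the graph of z and an interval in the other
    variable. The exponent arises as follows. A window of length r on the axis meets boundedly many
    cells of length about r. In each of them z runs uniformly through a height of about r^H, hence
    spends a fraction of about r^(1-H) of the time in a given interval of length r. This gives mass
    r^(2-H), and the other variable contributes a factor r. The numbers p_n are odd because an odd
    number of crossings of one half of a dyadic interval ends at the midpoint, where the crossings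
    of the other half start; this makes z continuous. For H = 0 they cannot stay bounded, yet
    consecutive cell lengths must remain comparable up to r^o(1). *)

(** On the cell of level [n] and index [j], the zigzag crosses the dyadic
    interval of level [n] whose lower end is [2^-n * (cell p n j).1], downwards
    if [(cell p n j).2].  All natural indices are allowed: on level 0 the
    function is [x] on [[0, +oo[]. *)
Fixpoint cell (p : nat -> nat) (n j : nat) : nat * bool :=
  if n is n'.+1 then
    let q := cell p n' (j %/ (2 * p n')) in
    let b := q.2 (+) (p n' <= j %% (2 * p n')) in
    (2 * q.1 + b, b (+) odd (j %% (2 * p n')))
  else (j, false).

(** Number of cells of level [n] in a cell of level [k]. *)
Definition ncells (p : nat -> nat) (k n : nat) := \prod_(k <= i < n) (2 * p i).

(** Both sides are the height of the common end point of two adjacent cells. *)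
Lemma cell_next (p : nat -> nat) (podd : forall i, odd (p i)) (n j : nat) :
  (cell p n j.+1).1 + (cell p n j.+1).2 = (cell p n j).1 + ~~ (cell p n j).2.
Proof.
elim: n j => [|n IH] j /=; first lia.
have p0 : 0 < p n by case: (p n) (podd n).
set q := j %/ (2 * p n); set r := j %% (2 * p n).
have jE : j = q * (2 * p n) + r by rewrite /q /r -divn_eq.
have rlt : r < 2 * p n by rewrite ltn_mod muln_gt0.
have [rl|re] := ltnP r.+1 (2 * p n).
  have -> : j.+1 %/ (2 * p n) = q.
    by rewrite jE -addnS divnMDl ?muln_gt0// divn_small// addn0.
  have -> : j.+1 %% (2 * p n) = r.+1 by rewrite jE -addnS modnMDl modn_small.
  have [pr|rp|pr] := ltngtP (p n) r.+1.
  - have -> : p n <= r by lia.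
    by case: ((cell p n q).2) => /=; case: (odd r) => /=; lia.
  - have -> : (p n <= r) = false by lia.
    by case: ((cell p n q).2) => /=; case: (odd r) => /=; lia.
  (* The passage between the two halves: [p n] being odd, the last crossing of the first half
     follows the direction of the parent cell and stops at the midpoint, where the other half
     starts. *)
  - have -> : (p n <= r) = false by lia.
    have := podd n; rewrite pr /=.
    by case: ((cell p n q).2) => /=; case: (odd r) => //=; lia.
have rE : r = (2 * p n).-1 by lia.
have -> : j.+1 %/ (2 * p n) = q.+1.
  have -> : j.+1 = q.+1 * (2 * p n) by rewrite jE rE; lia.
  by rewrite mulnK// muln_gt0.
have -> : j.+1 %% (2 * p n) = 0.
  have -> : j.+1 = q.+1 * (2 * p n) by rewrite jE rE; lia.
  by rewrite modnMl.
have -> : p n <= r by lia.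
have -> : odd r by rewrite rE; lia.
rewrite leqNgt p0 /=; move: (IH q).
by case: ((cell p n q).2); case: ((cell p n q.+1).2) => /=; lia.
Qed.

Lemma ncells_gt0 (p : nat -> nat) (podd : forall i, odd (p i)) k n :
  0 < ncells p k n.
Proof.
by apply: prodn_gt0 => i; rewrite muln_gt0 /= odd_gt0.
Qed.

Lemma ncellsS p k n : k <= n -> ncells p k n.+1 = ncells p k n * (2 * p n).
Proof. by move=> kn; rewrite /ncells big_nat_recr. Qed.

Lemma ncellsn p k : ncells p k k = 1.
Proof. by rewrite /ncells big_geq. Qed.

(** Each level appends one binary digit to the height, so dropping [n - k] digits recovers the
    height of the ancestor: nested cells have nested dyadic intervals. *)
Lemma cell_ancestor (p : nat -> nat) k n j :
  k <= n -> (cell p n j).1 %/ 2 ^ (n - k) = (cell p k (j %/ ncells p k n)).1.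
Proof.
elim: n j => [|n IH] j.
  by rewrite leqn0 => /eqP ->; rewrite ncellsn !divn1.
rewrite leq_eqVlt => /predU1P[->|]; first by rewrite subnn ncellsn !divn1.
rewrite ltnS => kn; rewrite ncellsS// [ncells p k n * _]mulnC divnMA -IH//=.
rewrite subSn// expnS divnMA; congr (_ %/ _).
by rewrite [2 * _.1]mulnC divnMDl//; case: (_ (+) _); rewrite addn0.
Qed.

(** Here [b] stands for the direction of the parent cell and [e] for a half of its dyadic interval.
    That the count depends on neither is what makes occupation times uniform. *)
Lemma count_half p (b e : bool) : \sum_(r < 2 * p) ((b (+) (p <= r)) == e) = p.
Proof.
rewrite -(big_mkord xpredT (fun r => nat_of_bool ((b (+) (p <= r)) == e))).
rewrite (@big_cat_nat _ _ _ p)//=; last by lia.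
rewrite (eq_big_nat _ _ (F2 := fun=> nat_of_bool (b == e))); last first.
  by move=> i /andP[_ ip]; rewrite leqNgt ip addbF.
rewrite [X in _ + X](eq_big_nat _ _
  (F2 := fun=> nat_of_bool (~~ b == e))); last first.
  by move=> i /andP[ip _]; rewrite ip addbT.
rewrite !sum_nat_const_nat; case: b e => -[] /=; lia.
Qed.

Lemma sum_nat_divmod (a b : nat) (F : nat -> nat) :
  \sum_(0 <= t < a * b) F t = \sum_(0 <= q < a) \sum_(0 <= r < b) F (q * b + r).
Proof.
elim: a => [|a IH]; first by rewrite mul0n !big_geq.
rewrite mulSnr (@big_cat_nat _ _ _ (a * b))//=; last by rewrite leq_addr.
rewrite IH big_nat_recr//=; congr (_ + _).
rewrite -{1}[a * b]addn0 addnC big_addn addKn.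
by apply: eq_bigr => r _; rewrite addnC.
Qed.

(** Each binary digit of [i] beyond level [k] selects exactly half of the subcells, so refining
    level [l] multiplies the count by [p l], wherever [i] lies in the dyadic interval of the
    cell. *)
Lemma count_cell (p : nat -> nat) (podd : forall i, odd (p i)) k n j i : k <= n ->
  \sum_(0 <= t < ncells p k n) ((cell p n (j * ncells p k n + t)).1 == i)
  = (i %/ 2 ^ (n - k) == (cell p k j).1) * \prod_(k <= l < n) p l.
Proof.
have base m i' : \sum_(0 <= t < ncells p m m)
    ((cell p m (j * ncells p m m + t)).1 == i')
    = (i' %/ 2 ^ (m - m) == (cell p m j).1) * \prod_(m <= l < m) p l.
  by rewrite ncellsn subnn big_nat1 addn0 big_geq// !muln1 divn1 eq_sym.
elim: n i => [|n IH] i; first by rewrite leqn0 => /eqP ->; exact: base.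
rewrite leq_eqVlt => /predU1P[->|]; first exact: base.
rewrite ltnS => kn; have p0 : 0 < 2 * p n by case: (p n) (podd n).
rewrite ncellsS// sum_nat_divmod.
have E q r : r < 2 * p n ->
    ((cell p n.+1
        (j * (ncells p k n * (2 * p n)) + (q * (2 * p n) + r))).1 == i : nat)
    = ((cell p n (j * ncells p k n + q)).1 == i./2)
      * (((cell p n (j * ncells p k n + q)).2 (+) (p n <= r)) == odd i).
  move=> rlt /=; rewrite mulnA addnA -mulnDl divnMDl// divn_small// addn0.
  rewrite modnMDl modn_small//.
  by case: (_ (+) _) => /=; case: eqP; case: eqP; case: eqP => //=; lia.
under eq_big_nat => q _.
  under eq_big_nat => r /andP[_ rlt] do rewrite (E q r rlt).
  rewrite -big_distrr /= big_mkord count_half.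
  over.
rewrite -big_distrl /= IH// big_nat_recr//= subSn// expnS divnMA divn2; lia.
Qed.

Local Open Scope classical_set_scope.
Local Open Scope ring_scope.

(** * The zigzag function *)

Lemma truncn_divn (R : realType) (x : R) (w : nat) : (0 < w)%N ->
  (Num.truncn (x * w%:R) %/ w)%N = Num.truncn x.
Proof.
move=> w0; have wR : 0 < w%:R :> R by rewrite ltr0n.
have [x0|x0] := ltP x 0.
  have t0 (y : R) : y < 0 -> Num.truncn y = 0%N.
    by move=> y0; apply/truncn0Pn; rewrite -ltNge (lt_trans y0).
  by rewrite !t0 ?div0n// pmulr_llt0.
have /andP[h1 h2] := truncn_itv x0.
apply/eqP; rewrite eqn_leq; apply/andP; split.
  rewrite -ltnS ltn_divLR// truncn_lt_nat ?mulr_ge0//.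
  by rewrite natrM ltr_pM2r.
rewrite leq_divRL// truncn_ge_nat ?mulr_ge0//.
by rewrite natrM ler_pM2r.
Qed.

Lemma truncn_near (R : realType) (x y : R) : `|x - y| <= 1 ->
  (Num.truncn x <= (Num.truncn y).+1)%N.
Proof.
move=> xy; rewrite truncn_le_nat.
have := truncnS_gt y; rewrite -[(_.+2)%:R]natr1.
by move: xy; rewrite ler_norml => /andP[_ ?] ?; lra.
Qed.

Definition height (R : realType) (p : nat -> nat) (n : nat) (x : R) : nat :=
  (cell p n (Num.truncn (x * (ncells p 0 n)%:R))).1.

(** [Num.truncn] is 0 on negative reals, so the function vanishes there. *)
Definition zigzag (R : realType) (p : nat -> nat) (x : R) : R :=
  sup [set (height p n x)%:R / 2 ^+ n | n in [set: nat]].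

Lemma height_divn (R : realType) (p : nat -> nat) (podd : forall i, odd (p i))
    (x : R) (m n : nat) : (m <= n)%N ->
  (height p n x %/ 2 ^ (n - m))%N = height p m x.
Proof.
move=> mn; rewrite /height cell_ancestor//; congr (cell _ _ _).1.
have -> : ncells p 0 n = (ncells p 0 m * ncells p m n)%N.
  by rewrite /ncells -big_cat_nat.
by rewrite natrM mulrA truncn_divn// ncells_gt0.
Qed.

(** Of two nested dyadic intervals, the lower end of either is below the upper end of the other.
    Hence the supremum defining [zigzag] lies in all of them. *)
Lemma height_approx (R : realType) (p : nat -> nat) (podd : forall i, odd (p i))
    (x : R) (m n : nat) :
  (height p m x)%:R / 2 ^+ m <= (height p n x).+1%:R / 2 ^+ n :> R.
Proof.
rewrite ler_pdivrMr ?exprn_gt0// mulrAC ler_pdivlMr ?exprn_gt0//.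
rewrite -!natrX -!natrM ler_nat.
have [mn|nm] := leqP m n.
  rewrite -(height_divn podd x mn).
  have -> : (2 ^ n = 2 ^ (n - m) * 2 ^ m)%N by rewrite -expnD subnK.
  rewrite mulnA leq_mul2r; apply/orP; right.
  by rewrite (leq_trans (leq_divM _ _)).
rewrite -(height_divn podd x (ltnW nm)).
have -> : (2 ^ m = 2 ^ (m - n) * 2 ^ n)%N by rewrite -expnD subnK// ltnW.
rewrite mulnA leq_mul2r; apply/orP; right.
by rewrite ltnW// ltn_ceil// expn_gt0.
Qed.

Lemma zigzag_bounds (R : realType) (p : nat -> nat)
    (podd : forall i, odd (p i)) (x : R) (n : nat) :
  (height p n x)%:R / 2 ^+ n <= zigzag p x <= (height p n x).+1%:R / 2 ^+ n.
Proof.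
apply/andP; split.
  apply: ub_le_sup; last by exists n.
  by exists ((height p 0 x).+1%:R / 2 ^+ 0) => _ [m _ <-]; exact: height_approx.
apply: ge_sup; first by exists ((height p 0 x)%:R / 2 ^+ 0), 0%N.
by move=> _ [m _ <-]; exact: height_approx.
Qed.

(** At this distance the cell indices differ by at most one, and adjacent cells meet at a common
    height by [cell_next]. *)
Lemma height_near (R : realType) (p : nat -> nat)
    (podd : forall i, odd (p i)) (x y : R) (n : nat) :
  `|x - y| <= (ncells p 0 n)%:R^-1 -> (height p n x <= (height p n y).+1)%N.
Proof.
have P0 : 0 < (ncells p 0 n)%:R :> R by rewrite ltr0n ncells_gt0.
rewrite -[_^-1]mul1r ler_pdivlMr// -{1}(gtr0_norm P0) -normrM mulrBl => xy.
have := truncn_near xy; rewrite distrC in xy; have := truncn_near xy.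
rewrite /height; set i := Num.truncn _; set j := Num.truncn _ => ji ij.
have [->//|->|<-] : [\/ i = j, i = j.+1 | i.+1 = j].
  have [?|?|?] := ltngtP i j; [apply: Or33|apply: Or32|apply: Or31]; lia.
- by have := cell_next podd n j; case: (_.2); case: (_.2) => /=; lia.
- by have := cell_next podd n i; case: (_.2); case: (_.2) => /=; lia.
Qed.

Lemma zigzag_near (R : realType) (p : nat -> nat)
    (podd : forall i, odd (p i)) (x y : R) (n : nat) :
  `|x - y| <= (ncells p 0 n)%:R^-1 -> `|zigzag p x - zigzag p y| <= 2 / 2 ^+ n.
Proof.
have main a b : `|a - b| <= (ncells p 0 n)%:R^-1 ->
    zigzag p a - zigzag p b <= 2 / 2 ^+ n :> R.
  move=> /(height_near podd) ab.
  have /andP[_ h1] := zigzag_bounds podd a n.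
  have /andP[h2 _] := zigzag_bounds podd b n.
  rewrite lerBlDl (le_trans h1)// -lerBlDr (le_trans _ h2)// -mulrBl.
  rewrite ler_pM2r ?invr_gt0 ?exprn_gt0// lerBlDr -natrD ler_nat addn2.
  by [].
move=> xy; rewrite ler_norml main// andbT lerNl opprB main//.
by rewrite distrC.
Qed.

Lemma zigzag_continuous (R : realType) (p : nat -> nat)
    (podd : forall i, odd (p i)) : continuous (zigzag p : R -> R).
Proof.
move=> x; apply/cvgrPdist_le => /= e e0.
have [n ne] : exists n, 2 / 2 ^+ n <= e :> R.
  exists (Num.truncn (2 / e)).+1; set n := _.+1.
  rewrite ler_pdivrMr ?exprn_gt0// mulrC -ler_pdivrMr//.
  rewrite (le_trans (ltW (truncnS_gt _)))// -natrX ler_nat.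
  by rewrite ltnW// ltn_expl.
near=> y; rewrite (le_trans _ ne)// zigzag_near//.
near: y; apply: (@cvgr_dist_le _ _ _ _ _ id) => //.
by rewrite invr_gt0 ltr0n ncells_gt0.
Unshelve. all: by end_near. Qed.

(** The bound is 2 because [x = 1] belongs to the level 0 cell of index 1, whose interval is
    [1, 2]. *)
Lemma zigzag_range (R : realType) (p : nat -> nat)
    (podd : forall i, odd (p i)) (x : R) : x <= 1 -> 0 <= zigzag p x <= 2.
Proof.
move=> x1; have /andP[h1 h2] := zigzag_bounds podd x 0.
rewrite (le_trans _ h1) ?divr_ge0//=; rewrite (le_trans h2)// expr0 divr1.
rewrite ler_nat ltnS /height /= ncellsn mulr1 truncn_le_nat.
by rewrite (le_lt_trans x1)// ltr1n.
Qed.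

(** * Distribution of the values of the zigzag *)

Lemma grid_cell_itv (R : realType) (w j : nat) : (0 < w)%N ->
  [set x : R | 0 <= x /\ Num.truncn (x * w%:R) = j]
  = `[j%:R / w%:R, j.+1%:R / w%:R[%classic.
Proof.
move=> w0; have wR : 0 < w%:R :> R by rewrite ltr0n.
apply/seteqP; split => x /=; rewrite in_itv/=.
  move=> [x0 xj]; rewrite ler_pdivrMr// ltr_pdivlMr//.
  by apply/andP; rewrite -xj; apply/andP/truncn_itv; rewrite mulr_ge0.
rewrite ler_pdivrMr// ltr_pdivlMr// => /andP[h1 h2]; split.
  by rewrite -(pmulr_lge0 _ wR) (le_trans _ h1).
by apply: truncn_def; rewrite h1.
Qed.

Lemma measure_grid_cells (R : realType) (w a l : nat) (Q : pred nat)
    (A := [set x : R | 0 <= x /\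
             exists2 t, (t < l)%N & Q t /\ Num.truncn (x * w%:R) = (a + t)%N]) :
  (0 < w)%N ->
  measurable A /\
  lebesgue_measure A = ((\sum_(0 <= t < l) Q t)%N%:R / w%:R)%:E.
Proof.
move=> w0; have wR : 0 < w%:R :> R by rewrite ltr0n.
rewrite {}/A; elim: l => [|l [IH1 IH2]].
  rewrite (_ : [set x | _] = set0); last by apply/seteqP; split => x //= [_ []].
  by rewrite big_geq// mul0r measure0.
set A := [set x | _] in IH1 IH2; set B := [set x | _].
pose C := if Q l then `[(a + l)%:R / w%:R, (a + l).+1%:R / w%:R[%classic
          else @set0 R.
have BE : B = A `|` C.
  rewrite /C -(grid_cell_itv _ _ w0); apply/seteqP; split => x /=.
    move=> [x0 [t]]; rewrite ltnS leq_eqVlt => /predU1P[->|tl] [Qt xt].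
      by right; rewrite Qt.
    by left; split=> //; exists t.
  move=> [[x0 [t tl h]]|]; first by split=> //; exists t => //; exact: ltnW.
  by case: ifPn => // Ql [x0 xt]; split => //; exists l.
have mC : measurable C by rewrite /C; case: ifP.
have AC : A `&` C = set0.
  rewrite /C -(grid_cell_itv _ _ w0); apply/seteqP; split => x //=.
  move=> [[x0 [t tl [Qt xt]]]]; case: ifP => // _ [_ xl].
  by move: tl; rewrite -(ltn_add2l a) -xl xt ltnn.
rewrite BE; split; first exact: measurableU.
rewrite [LHS]measureU// [X in (X + _)%E]IH2 big_nat_recr//= natrD mulrDl EFinD.
congr (_ + _)%E.
rewrite /C; case: ifPn => Ql; last by rewrite measure0 mul0r.
rewrite lebesgue_measure_itv/= lte_fin ltr_pM2r ?invr_gt0// ltr_nat ltnSn.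
by rewrite -EFinB -mulrBl -natrB// subSnn.
Qed.

(** On a cell, [zigzag p] is uniformly distributed over the dyadic interval: the factors [p l] of
    [count_cell] cancel against those in the number of cells of level [n], and only powers of 2
    remain. *)
Lemma measure_height_cell (R : realType) (p : nat -> nat)
    (podd : forall i, odd (p i)) (k n j i : nat)
    (A := [set x : R | [/\ 0 <= x, Num.truncn (x * (ncells p 0 k)%:R) = j
                         & height p n x = i]]) : (k <= n)%N ->
  measurable A /\ lebesgue_measure A =
    (((i %/ 2 ^ (n - k) == (cell p k j).1)%N)%:R
      / ((ncells p 0 k)%:R * 2 ^+ (n - k)))%:E.
Proof.
move=> kn; have n0 := ncells_gt0 podd 0 n; have w0 := ncells_gt0 podd k n.
have nE : ncells p 0 n = (ncells p 0 k * ncells p k n)%N.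
  by rewrite /ncells -big_cat_nat.
pose Q t := (cell p n (j * ncells p k n + t)).1 == i.
have := @measure_grid_cells R _ (j * ncells p k n) (ncells p k n) Q n0.
rewrite (_ : [set x : R | _] = A); last first.
  apply/seteqP; split => x /=.
    move=> [x0 [t tw [/eqP Qt xt]]]; split=> //; last by rewrite /height xt.
    rewrite -(truncn_divn (x * _) w0) -mulrA -natrM -nE xt divnMDl//.
    by rewrite divn_small// addn0.
  move=> [x0 xj xi]; split => //.
  exists (Num.truncn (x * (ncells p 0 n)%:R) %% ncells p k n)%N.
    by rewrite ltn_mod.
  have xE : Num.truncn (x * (ncells p 0 n)%:R) = (j * ncells p k n
      + Num.truncn (x * (ncells p 0 n)%:R) %% ncells p k n)%N.
    rewrite -xj -(truncn_divn (x * (ncells p 0 k)%:R) w0) -mulrA -natrM -nE.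
    exact: divn_eq.
  by split => //; rewrite /Q -xE; exact/eqP.
move=> [mA ->]; split=> //; congr (_%:E).
rewrite count_cell// natrM -mulrA; congr (_ * _).
rewrite nE natrM invfM mulrCA [RHS]invfM; congr (_ * _).
rewrite /ncells big_split/= prod_nat_const_nat natrM invfM mulrCA.
rewrite mulfV ?mulr1 ?natrX//.
rewrite pnatr_eq0 -lt0n; apply: prodn_gt0 => l; exact: odd_gt0.
Qed.

Definition zigzag_ball (R : realType) (p : nat -> nat) (x r : R) : set R :=
  `[0, 1] `&` [set y | `|x - y| <= r /\ `|zigzag p x - zigzag p y| <= r].

Lemma measurable_zigzag_ball (R : realType) (p : nat -> nat)
    (podd : forall i, odd (p i)) (x r : R) : measurable (zigzag_ball p x r).
Proof.
apply: measurableI => //.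
have mz : measurable_fun setT (zigzag p : R -> R).
  by apply: continuous_measurable_fun; exact: zigzag_continuous.
rewrite (_ : [set y | _] = `[x - r, x + r]%classic `&`
    (setT `&` zigzag p @^-1` `[zigzag p x - r, zigzag p x + r]%classic)).
  by apply: measurableI => //; exact: mz.
rewrite setTI; apply/seteqP; split => y /=; rewrite !in_itv/=.
  by rewrite !ler_distlC => -[].
by rewrite !ler_distlC => -[].
Qed.

Lemma measure_finite_cover d (T : measurableType d) (R : realType)
    (mu : {measure set T -> \bar R}) (A : set T) (F : nat -> set T) (n : nat)
    (c : R) : measurable A -> (forall k, measurable (F k)) ->
  A `<=` \bigcup_(k in `I_n) F k -> (forall k, (mu (F k) <= c%:E)%E) ->
  (mu A <= (n%:R * c)%:E)%E.
Proof.
move=> mA mF; rewrite bigcup_mkord => AF Fc.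
apply: (le_trans (content_subadditive mu (fun k _ => mF k) mA AF)).
apply: (@le_trans _ _ (\sum_(k < n) c%:E)%E).
  by apply: lee_sum => k _; exact: Fc.
by rewrite sumEFin lee_fin sumr_const card_ord mulr_natl.
Qed.

Lemma nat_window (a b m : nat) : (a <= b + m)%N -> (b <= a + m)%N ->
  exists2 s, (s < m.*2.+1)%N & (a + s - m = b)%N.
Proof. by exists (b + m - a)%N; lia. Qed.

(** The constant is 15 = 3 * 5. A point of the ball lies in the cell of [x] or in a neighbour, and
    its height at level [n] is within 2 of that of [x]: the values differ by at most 2^-n, and each
    is known up to 2^-n. *)
Lemma zigzag_ball_le (R : realType) (p : nat -> nat)
    (podd : forall i, odd (p i)) (x r : R) (k n : nat) : (k <= n)%N ->
  r <= (ncells p 0 k)%:R^-1 -> r <= (2 ^+ n)^-1 ->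
  (lebesgue_measure (zigzag_ball p x r)
    <= (15 / ((ncells p 0 k)%:R * 2 ^+ (n - k)))%:E)%E.
Proof.
move=> kn rk rn.
pose j0 := Num.truncn (x * (ncells p 0 k)%:R); pose i0 := height p n x.
pose A (j i : nat) := [set x : R | [/\ 0 <= x,
   Num.truncn (x * (ncells p 0 k)%:R) = j & height p n x = i]].
have mA j i : measurable (A j i) by exact: (measure_height_cell _ podd j i kn).1.
(* Where a subtraction truncates at 0, a set of the cover is merely repeated. *)
pose B (s : nat) := \bigcup_(t in `I_5) A (j0 + s - 1)%N (i0 + t - 2)%N.
have mB s : measurable (B s) by apply: bigcup_measurable.
have P0 : 0 < (ncells p 0 k)%:R :> R by rewrite ltr0n ncells_gt0.
have n0 : (0 : R) < 2 ^+ n by rewrite exprn_gt0.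
have SB : zigzag_ball p x r `<=` \bigcup_(s in `I_3) B s.
  move=> y [/=]; rewrite in_itv/= => /andP[y0 _] [xy zxy].
  have : `|x * (ncells p 0 k)%:R - y * (ncells p 0 k)%:R| <= 1.
    by rewrite -mulrBl normrM (gtr0_norm P0) -ler_pdivlMr// div1r (le_trans xy).
  move=> h; have := truncn_near h; move: h; rewrite distrC => /truncn_near.
  rewrite -/j0; set j := Num.truncn (y * _).
  rewrite -(addn1 j) -(addn1 j0) => jj0 j0j.
  have /andP[a1 a2] := zigzag_bounds podd x n.
  have /andP[b1 b2] := zigzag_bounds podd y n.
  move: a1 a2 b1 b2; rewrite -/i0; set i := height p n y.
  rewrite !ler_pdivrMr// !ler_pdivlMr// => a1 a2 b1 b2.
  have : `|zigzag p x * 2 ^+ n - zigzag p y * 2 ^+ n| <= 1.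
    by rewrite -mulrBl normrM (gtr0_norm n0) -ler_pdivlMr// div1r (le_trans zxy).
  rewrite ler_norml => /andP[c1 c2].
  have ii0 : (i <= i0 + 2)%N.
    by rewrite -(ler_nat R) natrD; move: a2; rewrite -natr1; lra.
  have i0i : (i0 <= i + 2)%N.
    by rewrite -(ler_nat R) natrD; move: b2; rewrite -natr1; lra.
  have [s s3 sE] := nat_window j0j jj0.
  have [t t5 tE] := nat_window i0i ii0.
  by exists s => //; exists t => //; rewrite -sE -tE.
have bound j i : (lebesgue_measure (A j i)
    <= (((ncells p 0 k)%:R * 2 ^+ (n - k))^-1)%:E)%E.
  rewrite [leLHS](measure_height_cell _ podd _ _ kn).2 lee_fin.
  have i_ge0 : 0 <= ((ncells p 0 k)%:R * 2 ^+ (n - k) : R)^-1.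
    by rewrite invr_ge0 mulr_ge0 ?exprn_ge0.
  by apply: ler_piMl => //; rewrite lern1 leq_b1.
rewrite (_ : 15 / _
  = 3%:R * (5%:R * ((ncells p 0 k)%:R * 2 ^+ (n - k))^-1)); last first.
  by rewrite mulrA -natrM.
apply: (@measure_finite_cover _ _ _ lebesgue_measure _ B) => // [|s].
  exact: measurable_zigzag_ball.
apply: (@measure_finite_cover _ _ _ lebesgue_measure _
  (fun t => A (j0 + s - 1)%N (i0 + t - 2)%N)) => // [|t|t].
- exact: mB.
- exact: mA.
- exact: bound.
Qed.

(** The ball contains all points of the level [k] cell of [x] that share its height at level [n].
    The condition [x < 1] keeps this half-open cell within [0, 1]. *)
Lemma zigzag_ball_ge (R : realType) (p : nat -> nat)
    (podd : forall i, odd (p i)) (x r : R) (k n : nat) : (k <= n)%N ->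
  0 <= x < 1 -> (ncells p 0 k)%:R^-1 <= r -> (2 ^+ n)^-1 <= r ->
  ((((ncells p 0 k)%:R * 2 ^+ (n - k))^-1)%:E
   <= lebesgue_measure (zigzag_ball p x r))%E.
Proof.
move=> kn /andP[x0 x1] rk rn.
pose j := Num.truncn (x * (ncells p 0 k)%:R); pose i := height p n x.
have [] := @measure_height_cell R p podd k n j i kn.
set A := [set y | _] => mA.
have -> : (i %/ 2 ^ (n - k) == (cell p k j).1)%N by rewrite /i height_divn.
rewrite mul1r => <-; apply: le_measure; rewrite ?inE//.
  exact: measurable_zigzag_ball.
have P0 : 0 < (ncells p 0 k)%:R :> R by rewrite ltr0n ncells_gt0.
have n0 : (0 : R) < 2 ^+ n by rewrite exprn_gt0.
have jlt : (j < ncells p 0 k)%N.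
  by rewrite truncn_lt_nat ?mulr_ge0// gtr_pMl.
move=> y [y0 yj yi]; split => /=.
  rewrite in_itv/= y0/= -(ler_pM2r P0) mul1r.
  have := truncnS_gt (y * (ncells p 0 k)%:R); rewrite yj => /ltW h.
  by rewrite (le_trans h)// ler_nat.
split.
  rewrite (le_trans _ rk)// -div1r ler_pdivlMr// -{1}(gtr0_norm P0) -normrM mulrBl.
  have := truncn_itv (mulr_ge0 x0 (ltW P0)).
  have := truncn_itv (mulr_ge0 y0 (ltW P0)).
  rewrite yj -/j -natr1 ler_norml => /andP[? ?] /andP[? ?]; apply/andP; split; lra.
rewrite (le_trans _ rn)// -div1r ler_pdivlMr// -{1}(gtr0_norm n0) -normrM mulrBl.
have := zigzag_bounds podd x n; have := zigzag_bounds podd y n.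
rewrite yi -/i -natr1 !ler_pdivrMr// !ler_pdivlMr// ler_norml.
by move=> /andP[? ?] /andP[? ?]; apply/andP; split; lra.
Qed.

(** * Choice of the subdivision *)

(** Powers of 3 are odd, and with these exponents the product of the steps telescopes: the sequence
    [e] prescribes the number of cells directly. *)
Definition pow3_steps (e : nat -> nat) (i : nat) : nat := 3 ^ (e i.+1 - e i).

Lemma odd_pow3_steps (e : nat -> nat) i : odd (pow3_steps e i).
Proof. by rewrite /pow3_steps oddX orbT. Qed.

Lemma ncells_pow3_steps (e : nat -> nat) (k : nat) :
  {homo e : i j / (i <= j)%N} -> e 0%N = 0%N ->
  ncells (pow3_steps e) 0 k = (2 ^ k * 3 ^ e k)%N.
Proof.
move=> emono e0; elim: k => [|k IH]; first by rewrite ncellsn e0.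
rewrite ncellsS// IH /pow3_steps mulnACA -expnSr -expnD subnKC//.
exact: emono.
Qed.

Lemma ln_ncells_pow3_steps (R : realType) (e : nat -> nat) (k : nat) :
  {homo e : i j / (i <= j)%N} -> e 0%N = 0%N ->
  ln (ncells (pow3_steps e) 0 k)%:R
  = k%:R * ln 2 + (e k)%:R * ln 3 :> R.
Proof.
move=> emono e0; rewrite ncells_pow3_steps// natrM lnM ?posrE ?ltr0n ?expn_gt0//.
by rewrite !natrX !lnXn ?ltr0n// !mulr_natl.
Qed.

(** Cells of level [k] have length [l = (ncells p 0 k)^-1] and height [2^-k];
    this expresses that [2^-k = l^(H + o(1))] and that consecutive lengths are
    comparable up to [l^o(1)]. *)
Definition growth_rate (R : realType) (H : R) (p : nat -> nat) : Prop :=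
  forall dlt : R, 0 < dlt -> exists C : R, forall k,
    ln (ncells p 0 k.+1)%:R - ln (ncells p 0 k)%:R
      + `|k%:R * ln 2 - H * ln (ncells p 0 k)%:R|
    <= dlt * ln (ncells p 0 k)%:R + C.

Lemma growth_rate_gt0 (R : realType) (H : R) : 0 < H <= 1 ->
  exists2 p, (forall i, odd (p i)) & growth_rate H p.
Proof.
move=> /andP[H0 H1]; pose a : R := ln 2; pose b : R := ln 3.
have a0 : 0 < a by rewrite ln_gt0// ltr1n.
have b0 : 0 < b by rewrite ln_gt0// ltr1n.
(* With 2^k 3^(e k) cells, the equation H (k ln 2 + e k ln 3) = k ln 2 has the solution e k = c
   k. *)
pose c := a / b * (H^-1 - 1).
have c0 : 0 <= c.
  by rewrite mulr_ge0 ?divr_ge0 ?(ltW a0) ?(ltW b0)// subr_ge0 invf_ge1.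
pose e k := Num.truncn (c * k%:R).
have emono : {homo e : i j / (i <= j)%N}.
  by move=> i j ij; apply: le_truncn; rewrite ler_wpM2l// ler_nat.
have e0 : e 0%N = 0%N by rewrite /e mulr0 truncn0.
exists (pow3_steps e) => [i|dlt dlt0]; first exact: odd_pow3_steps.
have eb k : c * k%:R - 1 <= (e k)%:R <= c * k%:R.
  have /andP[-> /ltW] := truncn_itv (mulr_ge0 c0 (ler0n R k)).
  by rewrite -natr1 andbT => h; rewrite lerBlDr.
have cb : c * b = a * H^-1 - a.
  by rewrite /c; field; rewrite !gt_eqF.
exists (a + b * (c + 1) + b) => k; rewrite !ln_ncells_pow3_steps// -/a -/b.
have X0 : 0 <= dlt * (k%:R * a + (e k)%:R * b).
  by rewrite !(mulr_ge0, addr_ge0)// ltW.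
have := eb k; have := eb k.+1; rewrite -natr1.
move: (ler0n R k) X0; set K : R := k%:R; set x : R := (e k)%:R.
set y : R := (e k.+1)%:R => K0 X0 /andP[y1 y2] /andP[x1 x2].
have i1 : y * b <= (c * (K + 1)) * b by rewrite ler_pM2r.
have i2 : (c * K - 1) * b <= x * b by rewrite ler_pM2r.
have i3 : x * b <= c * K * b by rewrite ler_pM2r.
have cbK : c * K * b = K * (a * H^-1) - K * a by rewrite mulrAC cb; ring.
have HK : H * (K * (a * H^-1)) = K * a by field; rewrite gt_eqF.
have j1 : H * (x * b) <= K * a - H * (K * a).
  have : H * (x * b) <= H * (c * K * b) by rewrite ler_pM2l.
  by rewrite cbK mulrBr HK.
have j2 : K * a - H * (K * a) - b <= H * (x * b).
  have : H * ((c * K - 1) * b) <= H * (x * b) by rewrite ler_pM2l.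
  rewrite mulrBl cbK mul1r !mulrBr HK => h; rewrite (le_trans _ h)//.
  by rewrite lerB// ler_piMl// ltW.
have ab : `|K * a - H * (K * a + x * b)| <= b.
  by rewrite ler_norml; apply/andP; split; lra.
have d1 : (K + 1) * a + y * b - (K * a + x * b) <= a + b * (c + 1) by lra.
by rewrite (le_trans (lerD d1 ab))// lerDr.
Qed.

(** Here k ln 2 has to be negligible against the logarithm of the number of cells, so [e] must grow
    faster than linearly. For a quadratic [e] the increments are linear in k, hence negligible
    too. *)
Lemma growth_rate0 (R : realType) :
  exists2 p, (forall i, odd (p i)) & growth_rate (0 : R) p.
Proof.
pose a : R := ln 2; pose b : R := ln 3.
have a0 : 0 < a by rewrite ln_gt0// ltr1n.
have b0 : 0 < b by rewrite ln_gt0// ltr1n.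
pose e k := (k ^ 2)%N.
have emono : {homo e : i j / (i <= j)%N} by move=> i j ij; rewrite leq_exp2r.
exists (pow3_steps e) => [i|dlt dlt0]; first exact: odd_pow3_steps.
pose u := 2 * a + 2 * b.
exists (a + b + u ^+ 2 / (dlt * b)) => k; rewrite !ln_ncells_pow3_steps// -/a -/b.
rewrite mul0r subr0 ger0_norm; last by rewrite mulr_ge0// ltW.
rewrite /e !natrX -natr1; set K : R := k%:R; have K0 : 0 <= K by [].
have db : 0 < dlt * b by rewrite mulr_gt0.
(* Completing the square. The linear terms to be absorbed amount to [(a + 2 * b) * K], which is at
   most [u * K]. *)
have h1 : u * K <= dlt * b * K ^+ 2 + u ^+ 2 / (dlt * b).
  rewrite -subr_ge0.
  have -> : dlt * b * K ^+ 2 + u ^+ 2 / (dlt * b) - u * K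
    = (dlt * b)^-1 * ((dlt * b * K - u / 2) ^+ 2 + 3 / 4 * u ^+ 2).
    by field; rewrite !gt_eqF.
  by rewrite mulr_ge0 ?invr_ge0 ?(ltW db)// addr_ge0 ?sqr_ge0// mulr_ge0 ?sqr_ge0.
have h2 : 0 <= dlt * (K * a) by rewrite !mulr_ge0// ltW.
have h3 : 0 <= a * K by rewrite mulr_ge0// ltW.
have -> : (K + 1) ^+ 2 * b = K ^+ 2 * b + 2 * K * b + b by ring.
have -> : dlt * (K * a + K ^+ 2 * b) = dlt * (K * a) + dlt * b * K ^+ 2 by ring.
move: h1; rewrite /u; lra.
Qed.

Lemma growth_rate_exists (R : realType) (H : R) : 0 <= H <= 1 ->
  exists2 p, (forall i, odd (p i)) & growth_rate H p.
Proof.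
move=> /andP[]; rewrite le_eqVlt => /predU1P[<- _|H0 H1].
  exact: growth_rate0.
by apply: growth_rate_gt0; rewrite H0.
Qed.

(** * Mass of zigzag balls of arbitrary radius *)

Lemma last_index (R : realType) (u : nat -> R) (y : R) :
  u 0%N <= y -> (exists n, y < u n) -> exists k, u k <= y < u k.+1.
Proof.
move=> u0 [n yn]; have exn : exists n, y < u n by exists n.
case: (ex_minnP exn) => -[|m] ym mmin; first by move: ym; rewrite ltNge u0.
by exists m; rewrite ym andbT leNgt; apply/negP => /mmin; rewrite ltnn.
Qed.

(** Two levels are attached to [r]: the last level [k] whose cells are no shorter than [r], and,
    inside the proof, the last level [n] with 2^-n >= r. The upper bound is taken at [k] and [n],
    the lower one at the next levels. Since 2^-n <= 2 r, the constant 15 doubles to 30. *)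
Lemma zigzag_ball_scale (R : realType) (p : nat -> nat)
    (podd : forall i, odd (p i)) (r : R) : 0 < r <= 1 ->
  exists k, ((ncells p 0 k)%:R <= r^-1 < (ncells p 0 k.+1)%:R)
  /\ forall x : R,
    (lebesgue_measure (zigzag_ball p x r)
      <= (30 * r * (2 ^+ k / (ncells p 0 k)%:R))%:E)%E /\
    (0 <= x < 1 -> ((r * (2 ^+ k / (ncells p 0 k.+1)%:R))%:E
      <= lebesgue_measure (zigzag_ball p x r))%E).
Proof.
move=> /andP[r0 r1].
have two_le k : (2 ^ k <= ncells p 0 k)%N.
  elim: k => [|k IH]; first by rewrite ncellsn.
  by rewrite ncellsS// expnSr leq_mul// leq_pmulr// odd_gt0.
have big : exists n, r^-1 < (2 ^ n)%:R :> R.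
  exists (Num.truncn r^-1).+1; rewrite (lt_trans (truncnS_gt _))//.
  by rewrite ltr_nat ltn_expl.
have ri1 : 1 <= r^-1 by rewrite invf_ge1.
have [||k /andP[k1 k2]] := @last_index R (fun k => (ncells p 0 k)%:R) r^-1.
- by rewrite ncellsn.
- by have [n rn] := big; exists n; rewrite (lt_le_trans rn)// ler_nat.
have [|//|n /andP[n1 n2]] := @last_index R (fun k => (2 ^ k)%:R) r^-1.
  by rewrite expn0.
have kn : (k <= n)%N.
  rewrite -ltnS -(ltn_exp2l (m := 2))// -(ltr_nat R).
  by rewrite (le_lt_trans _ n2)// (le_trans _ k1)// ler_nat.
have N0 i : 0 < (ncells p 0 i)%:R :> R by rewrite ltr0n ncells_gt0.
have T0 i : 0 < 2 ^+ i :> R by rewrite exprn_gt0.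
have twoB : 2 ^+ n = 2 ^+ (n - k) * 2 ^+ k :> R by rewrite -exprD subnK.
rewrite natrX in n1; rewrite natrX in n2.
have Ek : (2 ^+ (n - k))^-1 = 2 ^+ k / 2 ^+ n :> R.
  by rewrite twoB; field; rewrite !gt_eqF.
exists k; split=> [|x]; first by rewrite k1.
split=> [|x01].
  apply: (le_trans (zigzag_ball_le podd _ kn _ _)).
  - by rewrite -[r]invrK lef_pV2 ?posrE ?invr_gt0.
  - by rewrite -[r]invrK lef_pV2 ?posrE ?invr_gt0.
  rewrite lee_fin invfM Ek.
  have -> : 15 * ((ncells p 0 k)%:R^-1 * (2 ^+ k / 2 ^+ n))
    = 15 * (2 ^+ n)^-1 * (2 ^+ k / (ncells p 0 k)%:R) :> R by ring.
  rewrite ler_pM2r ?divr_gt0//.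
  have h : (2 ^+ n)^-1 <= 2 * r.
    move: n2; rewrite exprS -[r in X in _ -> X]invrK -ltr_pdivrMl// => h.
    rewrite -lef_pV2 ?posrE ?invr_gt0 ?mulr_gt0 ?invr_gt0// invfM !invrK.
    exact: ltW.
  by rewrite (_ : 30 = 15 * 2 :> R)// -?mulrA ?ler_pM2l// -natrM.
have kn1 : (k.+1 <= n.+1)%N by [].
apply: (le_trans _ (zigzag_ball_ge podd kn1 x01 _ _)).
- rewrite lee_fin subSS invfM Ek.
  have -> : (ncells p 0 k.+1)%:R^-1 * (2 ^+ k / 2 ^+ n)
    = (2 ^+ n)^-1 * (2 ^+ k / (ncells p 0 k.+1)%:R) :> R by ring.
  by rewrite ler_pM2r ?divr_gt0// -[r]invrK lef_pV2 ?posrE ?invr_gt0.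
- by rewrite -[r]invrK lef_pV2 ?posrE ?invr_gt0 ?ltW.
- by rewrite -[r]invrK lef_pV2 ?posrE ?invr_gt0 ?ltW.
Qed.

(** The lower bound on masses excludes [x = 1]; by continuity a nearby smaller point replaces it, at
    the cost of halving the radius. *)
Lemma zigzag_approx_lt1 (R : realType) (p : nat -> nat)
    (podd : forall i, odd (p i)) (x r : R) : 0 <= x <= 1 -> 0 < r ->
  exists2 y, 0 <= y < 1 & zigzag_ball p y (r / 2) `<=` zigzag_ball p x r.
Proof.
move=> /andP[x0 x1] r0; have [z z01 [zr1 zr2]] : exists2 z : R, 0 <= z < 1 &
    `|x - z| <= r / 2 /\ `|zigzag p x - zigzag p z| <= r / 2.
  move: x1; rewrite le_eqVlt => /predU1P[->|x1]; last first.
    by exists x; rewrite ?x0// !subrr normr0; split; rewrite divr_ge0// ltW.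
  have : \forall z \near (1 : R), `|zigzag p 1 - zigzag p z| <= r / 2.
    have /cvgrPdist_le := @zigzag_continuous R p podd 1.
    by apply; rewrite divr_gt0.
  rewrite -nbhs_nearE => -[e /= e0 ez].
  pose m := Num.min (Num.min (e / 2) (r / 2)) 1.
  have m0 : 0 < m by rewrite !lt_min !divr_gt0// ltr01.
  have me : m < e.
    by rewrite !gt_min; apply/orP; left; apply/orP; left; lra.
  have mr : m <= r / 2 by rewrite !ge_min lexx orbT.
  have m1 : m <= 1 by rewrite !ge_min lexx orbT.
  have nm : `|1 - (1 - m)| = m by rewrite opprB addrC subrK gtr0_norm.
  exists (1 - m); first by apply/andP; split; lra.
  by rewrite nm; split=> //; apply: ez; rewrite /= nm.
exists z => // y [y01 /= [yz yzz]]; split=> //=; split.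
  by rewrite (le_trans (ler_distD z _ _))// (splitr r) lerD.
by rewrite (le_trans (ler_distD (zigzag p z) _ _))// (splitr r) lerD.
Qed.

Lemma zigzag_ball_powR (R : realType) (H : R) (p : nat -> nat)
    (podd : forall i, odd (p i)) : 0 <= H <= 1 -> growth_rate H p ->
  forall dlt, 0 < dlt <= 1 -> exists2 C, 0 < C & forall r x,
    0 < r <= 1 -> 0 <= x <= 1 ->
    (lebesgue_measure (zigzag_ball p x r) <= (C * r `^ (2 - H - dlt))%:E)%E /\
    ((C^-1 * r `^ (2 - H + dlt))%:E <= lebesgue_measure (zigzag_ball p x r))%E.
Proof.
move=> /andP[H0 H1] grow dlt /andP[dlt0 dlt1].
have [C0 hC0] := grow dlt dlt0.
pose X k : R := ln (ncells p 0 k)%:R.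
have N0 i : 0 < (ncells p 0 i)%:R :> R by rewrite ltr0n ncells_gt0.
have XE k : (ncells p 0 k)%:R = expR (X k) by rewrite /X lnK ?posrE.
pose a : R := ln 2.
have twoE k : 2 ^+ k = expR (k%:R * a) :> R.
  by rewrite mulrC expRM_natr /a lnK// posrE.
have scale r : 0 < r <= 1 -> exists k, [/\ X k <= - ln r, - ln r <= X k.+1 &
   forall x,
    (lebesgue_measure (zigzag_ball p x r)
      <= (30 * expR (ln r + k%:R * a - X k))%:E)%E /\
    (0 <= x < 1 -> ((expR (ln r + k%:R * a - X k.+1))%:E
      <= lebesgue_measure (zigzag_ball p x r))%E)].
  move=> r01; have r0 : 0 < r by case/andP: r01.
  have [k [/andP[k1 k2] kx]] := zigzag_ball_scale podd r01.
  exists k; split.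
  - by rewrite -lnV ?posrE// ler_ln ?posrE ?invr_gt0.
  - by rewrite -lnV ?posrE// ler_ln ?posrE ?invr_gt0// ltW.
  - move=> x; rewrite !expRB !expRD -!XE -twoE lnK ?posrE// -!mulrA.
    by have := kx x; rewrite -!mulrA.
exists (30 * expR C0); first by rewrite mulr_gt0 ?expR_gt0.
move=> r x r01 x01; have r0 : 0 < r by case/andP: r01.
split.
  have [k [k1 k2 kx]] := scale r r01.
  rewrite (le_trans (kx x).1)// lee_fin /powR gt_eqF// -mulrA -expRD.
  rewrite ler_pM2l// ler_expR.
  have := hC0 k; rewrite -/(X k) -/(X k.+1) -/a.
  have := ler_norm (k%:R * a - H * X k).
  move: k1 k2; move: (X k) (X k.+1) (k%:R * a) (ln r) => Y Y' A l k1 k2 h1 h2.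
  (* The coefficient may be negative but is at most 1 in absolute value. Replacing [- l] by [Y] thus
     costs at most the gap [Y' - Y], which [growth_rate] controls. *)
  have : (1 - H - dlt) * (- l - Y) <= 1 * (Y' - Y).
    rewrite (le_trans (ler_norm _))// normrM ler_pM//.
      by rewrite ler_norml; apply/andP; split; lra.
    by rewrite ger0_norm; lra.
  lra.
have r2 : 0 < r / 2 <= 1.
  by case/andP: r01 => _ r1; rewrite divr_gt0//=; lra.
have [y y01 yx] := zigzag_approx_lt1 podd x01 r0.
apply: (@le_trans _ _ (lebesgue_measure (zigzag_ball p y (r / 2)))); last first.
  by apply: le_measure; rewrite ?inE//; exact: measurable_zigzag_ball.
have [k [k1 k2 kx]] := scale _ r2.
rewrite (le_trans _ ((kx y).2 y01))// lee_fin /powR gt_eqF//.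
rewrite invfM -mulrA -expRN -expRD.
have lr : ln (r / 2) = ln r - a by rewrite ln_div ?posrE.
(* The factor 2^-3 pays for the halved radius, as [2 - H + dlt <= 3]; the constant 30 from the upper
   bound covers it. *)
have e8 : 30^-1 <= expR (- (3%:R * a)).
  by rewrite expRN mulrC expRM_natr /a lnK ?posrE// lef_pV2 ?posrE// -natrX ler_nat.
have a0 : 0 < a by rewrite ln_gt0// ltr1n.
apply: (@le_trans _ _ (expR (- (3%:R * a)) * expR (- C0 + (2 - H + dlt) * ln r))).
  by rewrite ler_pM2r// expR_gt0.
rewrite -expRD ler_expR.
have := hC0 k; rewrite -/(X k) -/(X k.+1) -/a.
have := ler_norm (- (k%:R * a - H * X k)); rewrite normrN.
move: k1 k2; rewrite lr.
move: (X k) (X k.+1) (k%:R * a) (ln r) => Y Y' A l k1 k2 h1 h2.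
have : (1 - H + dlt) * Y <= (1 - H + dlt) * - (l - a) by rewrite ler_wpM2l//; lra.
have : (2 - H + dlt) * a <= 3 * a by rewrite ler_pM2r//; lra.
lra.
Qed.

(** * Dimensions of a set carrying a regular mass *)

Lemma edist3_ge0 (R : realType) (p q : R * R * R) : 0 <= edist3 p q.
Proof. exact: sqrtr_ge0. Qed.

Lemma edist3xx (R : realType) (p : R * R * R) : edist3 p p = 0.
Proof. by rewrite /edist3 !subrr expr0n /= !addr0 sqrtr0. Qed.

Lemma edist3C (R : realType) (p q : R * R * R) : edist3 p q = edist3 q p.
Proof.
rewrite /edist3 -(sqrrN (p.1.1 - _)) -(sqrrN (p.1.2 - _)) -(sqrrN (p.2 - _)).
by rewrite !opprB.
Qed.

Lemma edist3_triangle (R : realType) (q p r : R * R * R) :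
  edist3 p r <= edist3 p q + edist3 q r.
Proof.
rewrite /edist3.
set a := p.1.1 - q.1.1; set b := p.1.2 - q.1.2; set c := p.2 - q.2.
set a' := q.1.1 - r.1.1; set b' := q.1.2 - r.1.2; set c' := q.2 - r.2.
have -> : p.1.1 - r.1.1 = a + a' by rewrite /a /a'; ring.
have -> : p.1.2 - r.1.2 = b + b' by rewrite /b /b'; ring.
have -> : p.2 - r.2 = c + c' by rewrite /c /c'; ring.
set u := a ^+ 2 + _ + _; set v := a' ^+ 2 + _ + _.
have u0 : 0 <= u by rewrite !addr_ge0// sqr_ge0.
have v0 : 0 <= v by rewrite !addr_ge0// sqr_ge0.
have w : a * a' + b * b' + c * c' <= Num.sqrt u * Num.sqrt v.
  rewrite -sqrtrM// (le_trans (ler_norm _))// -sqrtr_sqr ler_wsqrtr//.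
  rewrite -subr_ge0.
  (* Lagrange's identity, which yields the Cauchy-Schwarz inequality. *)
  have -> : u * v - (a * a' + b * b' + c * c') ^+ 2 =
    (a * b' - b * a') ^+ 2 + (a * c' - c * a') ^+ 2 + (b * c' - c * b') ^+ 2.
    by rewrite /u /v; ring.
  by rewrite !addr_ge0// sqr_ge0.
rewrite -[leRHS]ger0_norm ?addr_ge0 ?sqrtr_ge0// -sqrtr_sqr ler_wsqrtr//.
rewrite [leRHS]sqrrD !sqr_sqrtr//.
have -> : (a + a') ^+ 2 + (b + b') ^+ 2 + (c + c') ^+ 2
  = u + (a * a' + b * b' + c * c') *+ 2 + v by rewrite /u /v; ring.
by rewrite lerD2r lerD2l lerMn2r w orbT.
Qed.

Lemma edist3_coord (R : realType) (p q : R * R * R) :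
  [/\ `|p.1.1 - q.1.1| <= edist3 p q, `|p.1.2 - q.1.2| <= edist3 p q
    & `|p.2 - q.2| <= edist3 p q].
Proof.
rewrite /edist3 -!sqrtr_sqr.
by split; apply: ler_wsqrtr; rewrite ?lerDr ?lerDl ?addr_ge0 ?sqr_ge0//;
   rewrite -?addrA ?lerDl ?addr_ge0 ?sqr_ge0// addrCA lerDl addr_ge0 ?sqr_ge0.
Qed.

(** The constant 2 stands in for the square root of 3. *)
Lemma edist3_le_coord (R : realType) (p q : R * R * R) (r : R) :
  `|p.1.1 - q.1.1| <= r -> `|p.1.2 - q.1.2| <= r -> `|p.2 - q.2| <= r ->
  edist3 p q <= 2 * r.
Proof.
move=> h1 h2 h3; have r0 : 0 <= r by rewrite (le_trans _ h1).
have sq (x : R) : `|x| <= r -> x ^+ 2 <= r ^+ 2.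
  by move=> xr; rewrite -real_normK ?num_real// lerXn2r ?nnegrE.
rewrite /edist3 -[leRHS]ger0_norm ?mulr_ge0// -sqrtr_sqr ler_wsqrtr//.
have -> : (2 * r) ^+ 2 = r ^+ 2 + r ^+ 2 + r ^+ 2 + r ^+ 2 by ring.
by rewrite (le_trans (lerD (lerD (sq _ h1) (sq _ h2)) (sq _ h3)))// lerDl sqr_ge0.
Qed.

Lemma diam3_ge (R : realType) (U : set (R * R * R)) (p q : R * R * R) :
  U p -> U q -> ((edist3 p q)%:E <= diam3 U)%E.
Proof. by move=> Up Uq; apply: ereal_sup_ubound; exists p => //; exists q. Qed.

Lemma diam3_real (R : realType) (U : set (R * R * R)) (p : R * R * R) (r : R) :
  U p -> (diam3 U <= r%:E)%E -> exists2 d, 0 <= d <= r & diam3 U = d%:E.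
Proof.
move=> Up; have := diam3_ge Up Up; rewrite edist3xx.
by case: (diam3 U) => [d| |]//; rewrite !lee_fin => d0 dr; exists d; rewrite ?d0.
Qed.

Lemma diam3_closed_ball_le (R : realType) (p : R * R * R) (r : R) :
  (diam3 (closed_ball3 p r) <= (2 * r)%:E)%E.
Proof.
apply: ge_ereal_sup => _ [x px [y py <-]]; rewrite lee_fin.
by rewrite (le_trans (edist3_triangle p _ _))// edist3C mulrDl mul1r lerD.
Qed.

Lemma diam3_closed_ball_ge (R : realType) (p : R * R * R) (r : R) : 0 <= r ->
  (r%:E <= diam3 (closed_ball3 p r))%E.
Proof.
move=> r0; pose q := (p.1.1 + r, p.1.2, p.2).
have pq : edist3 p q = r.
  rewrite /edist3/= !subrr opprD addrA subrr sub0r sqrrN expr0n/= !addr0.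
  by rewrite sqrtr_sqr ger0_norm.
rewrite -[in leLHS]pq; apply: diam3_ge; rewrite /closed_ball3/= ?pq//.
by rewrite edist3xx.
Qed.

Lemma diam_pow_ge0 (R : realType) (s : R) (U : set (R * R * R)) :
  (0 <= diam_pow s U)%E.
Proof. by rewrite /diam_pow; case: ifP => // _; exact: poweR_ge0. Qed.

Lemma diam_pow_fin (R : realType) (s d : R) (U : set (R * R * R))
    (p : R * R * R) : U p -> diam3 U = d%:E -> diam_pow s U = (d `^ s)%:E.
Proof.
move=> Up Ud; rewrite /diam_pow ifF; first by rewrite Ud poweR_EFin.
by apply/negP => /eqP U0; rewrite U0 in Up.
Qed.

Lemma diam_pow_closed_ball (R : realType) (s : R) (p : R * R * R) (r : R) :
  0 <= s -> 0 <= r ->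
  ((r `^ s)%:E <= diam_pow s (closed_ball3 p r) <= ((2 * r) `^ s)%:E)%E.
Proof.
move=> s0 r0; have pp : closed_ball3 p r p by rewrite /closed_ball3/= edist3xx.
have [d /andP[d0 d2] dE] := diam3_real pp (diam3_closed_ball_le p r).
have := diam3_closed_ball_ge p r0; rewrite (diam_pow_fin s pp dE) dE !lee_fin => rd.
by rewrite !ge0_ler_powR ?nnegrE// mulr_ge0.
Qed.

Lemma diam_pow_le (R : realType) (s r : R) (U : set (R * R * R)) :
  0 <= s -> 0 <= r -> (diam3 U <= r%:E)%E -> (diam_pow s U <= (r `^ s)%:E)%E.
Proof.
move=> s0 r0 Ur; have [U0|/set0P[p Up]] := eqVneq U set0.
  by rewrite /diam_pow U0 eqxx lee_fin powR_ge0.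
have [d /andP[d0 dr] dE] := diam3_real Up Ur.
by rewrite (diam_pow_fin s Up dE) lee_fin ge0_ler_powR ?nnegrE.
Qed.

(** Quantifying over measurable sets [E] inside (for [upper_mass], around) the
    preimage of a ball avoids any measurability assumption on [G]. *)
Definition lower_mass d (T : measurableType d) (R : realType)
    (mu : set T -> \bar R) (D : set T) (G : T -> R * R * R)
    (s c r0 : R) : Prop :=
  forall t r, D t -> 0 < r <= r0 -> exists E : set T,
    [/\ measurable E, E `<=` D, (forall t', E t' -> edist3 (G t) (G t') <= r)
      & ((c * r `^ s)%:E <= mu E)%E].

Definition upper_mass d (T : measurableType d) (R : realType)
    (mu : set T -> \bar R) (D : set T) (G : T -> R * R * R)
    (s C r0 : R) : Prop :=
  forall t r, D t -> 0 < r <= r0 -> exists E : set T,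
    [/\ measurable E, (forall t', D t' -> edist3 (G t) (G t') <= r -> E t')
      & (mu E <= (C * r `^ s)%:E)%E].

(** * Upper bounds on dimensions from lower bounds on masses *)

Lemma packing_sum_le d (T : measurableType d) (R : realType)
    (mu : {measure set T -> \bar R}) (D : set T) (G : T -> R * R * R)
    (s c r0 : R) (X : set nat) (t : nat -> T) (r : nat -> R) :
  measurable D -> lower_mass mu D G s c r0 -> finite_set X ->
  (forall i, X i -> D (t i) /\ 0 < r i <= r0) ->
  trivIset X (fun i => closed_ball3 (G (t i)) (r i)) ->
  (\sum_(i \in X) (c * r i `^ s)%:E <= mu D)%E.
Proof.
move=> mD low finX Xr tX.
pose P i (E : set T) := X i -> [/\ measurable E,
    E `<=` D, (forall t', E t' -> edist3 (G (t i)) (G t') <= r i)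
    & ((c * r i `^ s)%:E <= mu E)%E].
have [E hE] : {E : nat -> set T & forall i, P i (E i)}.
  apply: boolp.choice => i.
  have [Xi|nXi] := pselect (X i); last by exists set0.
  by have [Dt rr] := Xr i Xi; have [E ?] := low _ _ Dt rr; exists E.
apply: (@le_trans _ _ (\sum_(i \in X) mu (E i))%E).
  by apply: lee_fsum => // i /hE[].
rewrite -measure_fin_bigcup//; last by move=> i /hE[].
  apply: le_measure; rewrite ?inE//.
    by apply: fin_bigcup_measurable => // i /hE[].
  by apply: bigcup_sub => i /hE[].
apply/trivIsetP => i j Xi Xj ij; apply/seteqP; split => // x [Ei Ej].
have [_ _ /(_ _ Ei) xi _] := hE i Xi; have [_ _ /(_ _ Ej) xj _] := hE j Xj.
by move/trivIsetP : tX => /(_ i j Xi Xj ij)/seteqP[+ _] => /(_ (G x)); apply.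
Qed.

Lemma separated_disjoint (R : realType) (X : set nat) (p : nat -> R * R * R)
    (r : R) :
  (forall i j, X i -> X j -> i != j -> 2 * r < edist3 (p i) (p j)) ->
  trivIset X (fun i => closed_ball3 (p i) r).
Proof.
move=> sep; apply/trivIsetP => i j Xi Xj ij; apply/seteqP; split => // q [qi qj].
have := sep i j Xi Xj ij; rewrite ltNge (le_trans (edist3_triangle q _ _))//.
by rewrite (edist3C q) mulrDl mul1r lerD.
Qed.

(** The mass bound limits the size of a separated family, so one of largest size exists; by
    maximality, the balls of radius [2 * r] about its points cover the image of [B]. *)
Lemma maximal_separated d (T : measurableType d) (R : realType)
    (mu : {measure set T -> \bar R}) (D B : set T) (G : T -> R * R * R)
    (s c r0 r : R) :
  measurable D -> mu D = 1%E -> 0 < c ->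
  lower_mass mu D G s c r0 -> B `<=` D -> 0 < r <= r0 ->
  exists n (t : nat -> T), [/\ (forall i, (i < n)%N -> B (t i)),
    (forall i j, (i < n)%N -> (j < n)%N -> i != j ->
       2 * r < edist3 (G (t i)) (G (t j))),
    (forall x, B x -> exists2 i, (i < n)%N & edist3 (G (t i)) (G x) <= 2 * r)
    & n%:R * (c * r `^ s) <= 1].
Proof.
move=> mD muD c0 low BD r01.
pose P n (t : nat -> T) := (forall i, (i < n)%N -> B (t i)) /\
  (forall i j, (i < n)%N -> (j < n)%N -> i != j ->
       2 * r < edist3 (G (t i)) (G (t j))).
have cr0 : 0 < c * r `^ s by rewrite mulr_gt0// powR_gt0//; case/andP: r01.
have bnd n t : P n t -> n%:R * (c * r `^ s) <= 1.
  move=> [Pt Psep]; have := @packing_sum_le _ _ _ mu D G s c r0 `I_n t (fun=> r)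
    mD low (finite_II n).
  rewrite fsumEFin// muD lee_fin -fsbig_ord/= sumr_const card_ord.
  rewrite -[c * _ *+ _]mulr_natl.
  by apply=> [i /Pt/BD//|]; exact: separated_disjoint.
have [x0 _] : D !=set0.
  apply/set0P/negP => /eqP D0; move: muD; rewrite D0 measure0 => -[/eqP].
  by rewrite eq_sym oner_eq0.
pose Q n := `[< exists t, P n t >].
have exQ : exists n, Q n by exists 0%N; apply/asboolP; exists (fun=> x0).
have ubQ n : Q n -> (n <= (Num.truncn (c * r `^ s)^-1))%N.
  move/asboolP => [t /bnd]; rewrite -ler_pdivlMr// div1r => h.
  by rewrite truncn_ge_nat// invr_ge0 ltW.
case: (ex_maxnP exQ ubQ) => n /asboolP[t [Pt Psep]] nmax.
exists n, t; split=> //; last by apply: (bnd n t).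
move=> x Bx; apply: contrapT => nx.
have far i : (i < n)%N -> 2 * r < edist3 (G (t i)) (G x).
  by move=> ni; rewrite ltNge; apply/negP => h; apply: nx; exists i.
have : Q n.+1.
  apply/asboolP; exists (fun i => if (i < n)%N then t i else x); split=> [i _|i j].
    by case: ifPn => // /Pt.
  rewrite !ltnS; case: (ltnP i n) => ni; case: (ltnP j n) => nj /= i' j' ij.
  - exact: Psep.
  - exact: far.
  - by rewrite edist3C far.
  - by move: ij; rewrite eqn_leq (leq_trans i' nj) (leq_trans j' ni).
by move/nmax; rewrite ltnn.
Qed.

Lemma powR_small (R : realType) (a K e d0 : R) : 0 < a -> 0 < K -> 0 < e ->
  0 < d0 -> exists2 d, 0 < d <= d0 & K * d `^ a <= e.
Proof.
move=> a0 K0 e0 d00; pose m := Num.min d0 ((e / K) `^ a^-1).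
have m0 : 0 < m by rewrite lt_min d00 powR_gt0// divr_gt0.
exists m; first by rewrite m0 ge_min lexx.
rewrite mulrC -ler_pdivlMr//.
have -> : e / K = ((e / K) `^ a^-1) `^ a.
  by rewrite -powRrM mulVf ?gt_eqF// powRr1// ltW// divr_gt0.
apply: ge0_ler_powR; rewrite ?nnegrE ?powR_ge0 ?invr_ge0 ?(ltW a0) ?(ltW m0)//.
by rewrite /m ge_min lexx orbT.
Qed.

(** A maximal family is taken at radius [dlt / 4], so that the covering balls have radius [dlt / 2]
    and diameter at most [dlt]. The empty sets beyond [n] contribute 0 to Hausdorff sums. *)
Lemma finite_ball_cover d (T : measurableType d) (R : realType)
    (mu : {measure set T -> \bar R}) (D : set T) (G : T -> R * R * R)
    (s c r0 dlt : R) :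
  measurable D -> mu D = 1%E -> 0 < c -> lower_mass mu D G s c r0 ->
  0 < dlt <= 4 * r0 ->
  exists n (U : nat -> set (R * R * R)), [/\ G @` D `<=` \bigcup_(i in `I_n) U i,
    forall i, (diam3 (U i) <= dlt%:E)%E, forall i, (n <= i)%N -> U i = set0 &
    n%:R <= 4 `^ s / c * dlt `^ (- s)].
Proof.
move=> mD muD c0 low /andP[d0 d4].
have r01 : 0 < dlt / 4 <= r0 by rewrite divr_gt0//= ler_pdivrMr// mulrC.
have [n [t [_ _ cov nb]]] := maximal_separated mD muD c0 low (@subset_refl _ D) r01.
pose U i := if (i < n)%N then closed_ball3 (G (t i)) (2 * (dlt / 4)) else set0.
exists n, U; split.
- move=> _ [x Dx <-]; have [i ni xi] := cov x Dx.
  by exists i => //; rewrite /U ni.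
- move=> i; rewrite /U; case: ifP => _.
    rewrite (le_trans (diam3_closed_ball_le _ _))// lee_fin; lra.
  by apply: ge_ereal_sup => _ [? []].
- by move=> i; rewrite leqNgt /U => /negbTE ->.
- have E : (dlt / 4) `^ s = dlt `^ s / 4 `^ s.
    rewrite powRM ?invr_ge0 ?(ltW d0)//; congr (_ * _).
    by rewrite -powR_inv1// -powRrM mulN1r powRN.
  rewrite powRN; move: nb; rewrite E.
  have u0 := powR_gt0 s d0; have v0 : 0 < 4 `^ s :> R by rewrite powR_gt0.
  have -> : n%:R * (c * (dlt `^ s / 4 `^ s)) = n%:R / (4 `^ s / c / dlt `^ s).
    by field; rewrite !gt_eqF.
  by rewrite ler_pdivrMr ?mul1r// !divr_gt0.
Qed.

Lemma hausdorff_content_ge0 (R : realType) (s dlt : R) (A : set (R * R * R)) :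
  (0 <= hausdorff_content s dlt A)%E.
Proof.
apply: le_ereal_inf_tmp => _ [U _ <-]; apply: nneseries_ge0 => n _ _.
exact: diam_pow_ge0.
Qed.

Lemma lower_mass_hausdorff d (T : measurableType d) (R : realType)
    (mu : {measure set T -> \bar R}) (D : set T) (G : T -> R * R * R)
    (s s' c r0 : R) :
  measurable D -> mu D = 1%E -> 0 < c -> 0 < r0 -> lower_mass mu D G s c r0 ->
  0 <= s -> s < s' -> hausdorff_measure s' (G @` D) = 0%E.
Proof.
move=> mD muD c0 r00 low s0 ss'; apply/eqP; rewrite eq_le; apply/andP; split.
  apply: ge_ereal_sup => _ [dlt /= d0 <-]; apply/lee_addgt0Pr => e e0.
  rewrite add0e; have K0 : 0 < 4 `^ s / c by rewrite divr_gt0// powR_gt0.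
  have dd0 : 0 < Num.min dlt (4 * r0) by rewrite lt_min d0 mulr_gt0.
  have ss0 : 0 < s' - s by rewrite subr_gt0.
  have [d1 /andP[d10 d1m] d1e] := powR_small ss0 K0 e0 dd0.
  have d1r : 0 < d1 <= 4 * r0 by rewrite d10 (le_trans d1m)// ge_min lexx orbT.
  have [n [U [cov Ud Un nb]]] := finite_ball_cover mD muD c0 low d1r.
  apply: (@le_trans _ _ (\sum_(0 <= i <oo) diam_pow s' (U i))%E).
    apply: ereal_inf_lbound; exists U => //; split.
      by move=> x /cov[i _ Ux]; exists i.
    move=> i; rewrite (le_trans (Ud i))// lee_fin (le_trans d1m)//.
    by rewrite ge_min lexx.
  rewrite (nneseries_split 0 n); last by move=> *; exact: diam_pow_ge0.
  rewrite [X in (_ + X)%E]eseries0 ?adde0; last first.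
    by move=> i ni _; rewrite /diam_pow Un ?eqxx.
  rewrite add0n big_mkord; apply: (@le_trans _ _ (\sum_(i < n) (d1 `^ s')%:E)%E).
    by apply: lee_sum => i _; apply: diam_pow_le => //; lra.
  rewrite sumEFin lee_fin sumr_const card_ord -[d1 `^ _ *+ _]mulr_natl.
  rewrite (le_trans _ d1e)// powRD; last by rewrite gt_eqF ?implybT.
  rewrite [d1 `^ s' * _]mulrC mulrA ler_wpM2r ?powR_ge0//.
apply: (@le_trans _ _ (hausdorff_content s' 1 (G @` D))).
  exact: hausdorff_content_ge0.
by apply: ereal_sup_ubound; exists 1 => /=.
Qed.

Lemma packing_content_ge0 (R : realType) (s dlt : R) (A : set (R * R * R)) :
  (0 <= packing_content s dlt A)%E.
Proof.
apply: ereal_sup_ubound; exists set0, (fun=> (0, 0, 0)), (fun=> 0).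
by rewrite esum_set0; split=> //; split=> //; exact: trivIset_set0.
Qed.

Lemma packing_premeasure_ge0 (R : realType) (s : R) (A : set (R * R * R)) :
  (0 <= packing_premeasure s A)%E.
Proof. by apply: le_ereal_inf_tmp => _ [dl _ <-]; exact: packing_content_ge0. Qed.

Lemma packing_premeasure0 (R : realType) (s : R) :
  packing_premeasure s (@set0 (R * R * R)) = 0%E.
Proof.
apply/eqP; rewrite eq_le packing_premeasure_ge0 andbT.
apply: (@le_trans _ _ (packing_content s 1 (@set0 (R * R * R)))).
  by apply: ereal_inf_lbound; exists 1 => /=.
apply: ge_ereal_sup => _ [D [x [r [[Dx _] ->]]]].
rewrite (_ : D = set0) ?esum_set0//.
by apply/seteqP; split=> // n /Dx[].
Qed.

(** The excess exponent [s' - s] makes each term a small multiple of the mass [c * r i ^ s], and by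
    disjointness these masses sum to at most 1. The premeasure of the whole set already vanishes, so
    the trivial cover suffices. *)
Lemma lower_mass_packing d (T : measurableType d) (R : realType)
    (mu : {measure set T -> \bar R}) (D : set T) (G : T -> R * R * R)
    (s s' c r0 : R) :
  measurable D -> mu D = 1%E -> 0 < c -> 0 < r0 -> lower_mass mu D G s c r0 ->
  0 <= s -> s < s' -> packing_measure s' (G @` D) = 0%E.
Proof.
move=> mD muD c0 r00 low s0 ss'.
have pre0 : packing_premeasure s' (G @` D) = 0%E.
  apply/eqP; rewrite eq_le packing_premeasure_ge0 andbT.
  apply/lee_addgt0Pr => e e0; rewrite add0e.
  have K0 : 0 < 2 `^ s' / c by rewrite divr_gt0// powR_gt0.
  have ss0 : 0 < s' - s by rewrite subr_gt0.
  have [d1 /andP[d10 d1r] d1e] := powR_small ss0 K0 e0 r00.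
  apply: (@le_trans _ _ (packing_content s' d1 (G @` D))).
    by apply: ereal_inf_lbound; exists d1.
  apply: ge_ereal_sup => _ [X [x [r [[Xr tX] ->]]]].
  apply: ge_ereal_sup => _ [Y [finY YX] <-].
  have [t tx] : {t : nat -> T & forall n, Y n -> D (t n) /\ G (t n) = x n}.
    apply: (boolp.choice (P := fun n y => Y n -> D y /\ G y = x n)) => n.
    have [Yn|nYn] := pselect (Y n).
      by have [[y Dy yx] _] := Xr n (YX _ Yn); exists y.
    have [x0 _] : D !=set0.
      apply/set0P/negP => /eqP D0; move: muD; rewrite D0 measure0 => -[/eqP].
      by rewrite eq_sym oner_eq0.
    by exists x0.
  apply: (@le_trans _ _ (\sum_(i \in Y) ((2 `^ s' / c * d1 `^ (s' - s))%:E
      * (c * r i `^ s)%:E))%E).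
    apply: lee_fsum => // i Yi; have [_ /andP[ri0 rid]] := Xr i (YX _ Yi).
    have s'0 : 0 <= s' by lra.
    have /andP[_ h] := diam_pow_closed_ball (x i) s'0 (ltW ri0).
    rewrite (le_trans h)// -EFinM lee_fin powRM ?(ltW ri0)//.
    have -> : 2 `^ s' / c * d1 `^ (s' - s) * (c * r i `^ s)
      = 2 `^ s' * (d1 `^ (s' - s) * r i `^ s) by field; rewrite gt_eqF.
    rewrite ler_pM2l ?powR_gt0//.
    have -> : r i `^ s' = r i `^ (s' - s) * r i `^ s.
      by rewrite -powRD ?subrK// (gt_eqF ri0) implybT.
    rewrite ler_wpM2r ?powR_ge0// ge0_ler_powR//.
    - exact: ltW.
    - by rewrite nnegrE ltW.
    - by rewrite nnegrE ltW.
  rewrite -ge0_mule_fsumr; last first.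
    by move=> i; rewrite lee_fin mulr_ge0 ?powR_ge0 ?ltW.
  rewrite (le_trans _
    (_ : ((2 `^ s' / c * d1 `^ (s' - s))%:E * 1 <= e%:E)%E))//; last first.
    by rewrite mule1 lee_fin.
  rewrite lee_wpmul2l// -?muD.
    by rewrite lee_fin mulr_ge0 ?powR_ge0// ltW.
  apply: (packing_sum_le (t := t) mD low finY) => [i Yi|].
    have [? _] := tx i Yi; have [_ /andP[ri0 rid]] := Xr i (YX _ Yi).
    by rewrite ri0 (le_trans rid).
  apply/trivIsetP => i j Yi Yj ij; rewrite !(tx _ _).2//.
  by move/trivIsetP : tX; apply => //; exact: YX.
apply/eqP; rewrite eq_le; apply/andP; split; last first.
  apply: le_ereal_inf_tmp => _ [F _ <-]; apply: nneseries_ge0 => n _ _.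
  exact: packing_premeasure_ge0.
apply: ereal_inf_lbound => /=; exists (fun n => if n is 0%N then G @` D else set0).
  by move=> x Ax; exists 0%N.
by apply: eseries0 => -[|n] _ _; [exact: pre0|exact: packing_premeasure0].
Qed.

(** * Lower bounds on dimensions from upper bounds on masses *)

Lemma cover_mass_le d (T : measurableType d) (R : realType)
    (mu : {measure set T -> \bar R}) (D : set T) (G : T -> R * R * R) (K : R)
    (F : nat -> set (R * R * R)) (a : nat -> \bar R) :
  measurable D -> 0 <= K -> (forall n, (0 <= a n)%E) ->
  G @` D `<=` \bigcup_n F n ->
  (forall n e, 0 < e -> exists E : set T,
     [/\ measurable E, (forall t, D t -> F n (G t) -> E t)
       & (mu E <= K%:E * a n + e%:E)%E]) ->
  (mu D <= K%:E * \sum_(0 <= n <oo) a n)%E.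
Proof.
move=> mD K0 a0 cov hE; apply/lee_addgt0Pr => e e0.
have e2 n : 0 < e / (2 ^ n.+1)%:R by rewrite divr_gt0// ltr0n expn_gt0.
have [E EE] := boolp.choice (fun n => hE n _ (e2 n)).
apply: (@le_trans _ _ (\sum_(0 <= n <oo) mu (E n))%E).
  apply: measure_sigma_subadditive => // [n|t Dt]; first by have [] := EE n.
  have [n _ Fn] : (\bigcup_n F n) (G t) by apply: cov; exists t.
  by exists n => //; have [_ /(_ t Dt Fn)] := EE n.
apply: (@le_trans _ _ (\sum_(0 <= n <oo)
    (K%:E * a n + (e / (2 ^ n.+1)%:R)%:E))%E).
  by apply: lee_nneseries => // n _; have [] := EE n.
rewrite -nneseriesZl//; apply: epsilon_trick => // [n|]; last exact: ltW.
by rewrite mule_ge0.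
Qed.

Lemma upper_mass_diam d (T : measurableType d) (R : realType)
    (mu : {measure set T -> \bar R}) (D : set T) (G : T -> R * R * R)
    (s C r0 r : R) (U : set (R * R * R)) : 0 <= C ->
  upper_mass mu D G s C r0 -> 0 < r <= r0 -> (diam3 U <= r%:E)%E ->
  exists E : set T, [/\ measurable E, (forall t, D t -> U (G t) -> E t)
    & (mu E <= (C * r `^ s)%:E)%E].
Proof.
move=> C0 up r01 Ur.
have [[t [Dt Ut]]|no] := pselect (exists t, D t /\ U (G t)).
  have [E [mE DE muE]] := up t r Dt r01; exists E; split=> // t' Dt' Ut'.
  by apply: DE => //; rewrite -lee_fin (le_trans _ Ur)// diam3_ge.
exists set0; split=> // [t Dt Ut|]; first by apply: no; exists t.
by rewrite measure0 lee_fin mulr_ge0// powR_ge0.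
Qed.

(** The mass bound requires a positive radius. If [U] has diameter 0 and [s > 0], the error [e]
    absorbs the mass of a small ball; if [s = 0], a nonempty [U] contributes 1 by convention, which
    is enough. *)
Lemma upper_mass_diam_pow d (T : measurableType d) (R : realType)
    (mu : {measure set T -> \bar R}) (D : set T) (G : T -> R * R * R)
    (s C r0 e : R) (U : set (R * R * R)) : 0 <= s -> 0 < C -> 0 < r0 -> 0 < e ->
  upper_mass mu D G s C r0 -> (diam3 U <= r0%:E)%E ->
  exists E : set T, [/\ measurable E, (forall t, D t -> U (G t) -> E t)
    & (mu E <= C%:E * diam_pow s U + e%:E)%E].
Proof.
move=> s0 C0 r00 e0 up Ur.
have [[t [Dt Ut]]|no] := pselect (exists t, D t /\ U (G t)); last first.
  exists set0; split=> // [t Dt Ut|]; first by apply: no; exists t.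
  rewrite measure0 adde_ge0 ?lee_fin ?(ltW e0)//.
  by rewrite mule_ge0 ?lee_fin ?(ltW C0)// diam_pow_ge0.
suff [r r01 [Udr h]] : exists2 r, 0 < r <= r0 & (diam3 U <= r%:E)%E /\
    ((C * r `^ s)%:E <= C%:E * diam_pow s U + e%:E)%E.
  have [E [mE DE muE]] := upper_mass_diam (ltW C0) up r01 Udr.
  by exists E; split=> //; exact: le_trans h.
have [d1 /andP[d10 d1r] dE] := diam3_real Ut Ur.
rewrite (diam_pow_fin s Ut dE) dE.
move: d10; rewrite le_eqVlt => /predU1P[d10|d10]; last first.
  by exists d1; rewrite ?d10//; split=> //; rewrite -EFinM leeDl// lee_fin ltW.
move: s0; rewrite le_eqVlt => /predU1P[<-|s0].
  exists r0; first by rewrite r00 lexx.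
  by rewrite !powRr0 -EFinM leeDl ?lee_fin ?(ltW e0)// -d10 ltW.
have [r r01 re] := powR_small s0 C0 e0 r00.
exists r => //; rewrite -d10 lee_fin; split; first by case/andP: r01 => /ltW.
by rewrite -EFinM -EFinD lee_fin (le_trans re)// lerDr mulr_ge0 ?powR_ge0// ltW.
Qed.

(** Mass distribution principle: the content at the single scale [r0] is already at least [C^-1]. *)
Lemma upper_mass_hausdorff d (T : measurableType d) (R : realType)
    (mu : {measure set T -> \bar R}) (D : set T) (G : T -> R * R * R)
    (s C r0 : R) : measurable D -> mu D = 1%E -> 0 <= s -> 0 < C -> 0 < r0 ->
  upper_mass mu D G s C r0 -> hausdorff_measure s (G @` D) <> 0%E.
Proof.
move=> mD muD s0 C0 r00 up H0.
have : (hausdorff_content s r0 (G @` D) < (C^-1)%:E)%E.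
  apply: (@le_lt_trans _ _ (hausdorff_measure s (G @` D))).
    by apply: ereal_sup_ubound; exists r0.
  by rewrite H0 lte_fin invr_gt0.
move=> /ereal_inf_lt[_ [U [cov Ud] <-]]; rewrite ltNge => /negP; apply.
have := cover_mass_le (mu := mu) mD (ltW C0) (fun n => diam_pow_ge0 s (U n)) cov.
rewrite muD => h; rewrite -[leLHS]mule1.
rewrite lee_pdivrMl//; apply: h => n e e0.
exact: upper_mass_diam_pow s0 C0 r00 e0 up (Ud n).
Qed.

(** The lower mass bound, with an arbitrary exponent [s1], serves to make separated families finite;
    the estimate itself comes from the upper bound of exponent [s]. *)
Lemma upper_mass_packing_premeasure d (T : measurableType d) (R : realType)
    (mu : {measure set T -> \bar R}) (D : set T) (G : T -> R * R * R)
    (s C r0 s1 c r1 e : R) (F : set (R * R * R)) :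
  measurable D -> mu D = 1%E -> 0 <= s -> 0 < C -> 0 < r0 -> 0 < c -> 0 < r1 ->
  0 < e -> upper_mass mu D G s C r0 -> lower_mass mu D G s1 c r1 ->
  exists E : set T, [/\ measurable E, (forall t, D t -> F (G t) -> E t)
    & (mu E <= (C * 2 `^ s)%:E * packing_premeasure s F + e%:E)%E].
Proof.
move=> mD muD s0 C0 r00 c0 r10 e0 up low; set K := C * 2 `^ s.
have K0 : 0 < K by rewrite mulr_gt0// powR_gt0.
have := packing_premeasure_ge0 s F.
case pE : (packing_premeasure s F) => [q| |]// q0; last first.
  (* An infinite premeasure makes the bound trivial. *)
  by exists D; split=> //; rewrite mulry gtr0_sg// mul1e addye// leey.
have pfin : packing_premeasure s F \is a fin_num by rewrite pE.
have eK : 0 < e / K by rewrite divr_gt0.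
have [_ [dl /= dl0 <-]] := lb_ereal_inf_adherent eK pfin.
rewrite -/(packing_premeasure s F) pE => lt_content.
(* A maximal packing of F by balls of one small radius r: the balls of radius
   2r cover F, so no Vitali covering argument is needed. *)
pose r := Num.min dl (Num.min (r0 / 2) r1).
have r_gt0 : 0 < r by rewrite !lt_min dl0 r10 divr_gt0.
have rdl : r <= dl by rewrite ge_min lexx.
have rr0 : 2 * r <= r0 by rewrite mulrC -ler_pdivlMr// !ge_min lexx orbT.
have rr1 : 0 < r <= r1 by rewrite r_gt0/= !ge_min lexx !orbT.
have [n [t [tF sep tcov _]]] := maximal_separated mD muD c0 low
  (@subIsetl _ D (G @^-1` F)) rr1.
have r20 : 0 < 2 * r <= r0 by rewrite mulr_gt0.
have [E EE] : {E : nat -> set T & forall i, (i < n)%N -> [/\ measurable (E i),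
    (forall t', D t' -> edist3 (G (t i)) (G t') <= 2 * r -> E i t')
    & (mu (E i) <= (C * (2 * r) `^ s)%:E)%E]}.
  apply: (boolp.choice (P := fun i E => (i < n)%N -> [/\ measurable E,
    (forall t', D t' -> edist3 (G (t i)) (G t') <= 2 * r -> E t')
    & (mu E <= (C * (2 * r) `^ s)%:E)%E])) => i.
  have [/tF[Dt _]|_] := ltnP i n; last by exists set0.
  by have [E ?] := up _ _ Dt r20; exists E.
pose E' i := if (i < n)%N then E i else set0.
have mE' i : measurable (E' i) by rewrite /E'; case: ifP => // /EE[].
exists (\bigcup_(i in `I_n) E' i); split.
- exact: bigcup_measurable.
- move=> x Dx Fx; have [i ni xi] := tcov x (conj Dx Fx).
  by exists i => //; rewrite /E' ni; have [_ + _] := EE i ni; exact.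
apply: (@le_trans _ _ (n%:R * (C * (2 * r) `^ s))%:E).
  apply: (measure_finite_cover (mu := mu) (F := E')) => // [|i].
    exact: bigcup_measurable.
  rewrite /E'; case: ifP => [/EE[]//|_].
  by rewrite measure0 lee_fin mulr_ge0 ?powR_ge0// ltW.
have cont : ((n%:R * r `^ s)%:E <= packing_content s dl F)%E.
  apply: (@le_trans _ _ (\esum_(i in `I_n) diam_pow s (closed_ball3 (G (t i)) r))%E).
    rewrite esum_fset//; last by move=> i _; exact: diam_pow_ge0.
    rewrite -fsbig_ord/=.
    apply: (@le_trans _ _ (\sum_(i < n) (r `^ s)%:E)%E).
      by rewrite sumEFin lee_fin sumr_const card_ord mulr_natl.
    apply: lee_sum => i _.
    by have /andP[] := diam_pow_closed_ball (G (t i)) s0 (ltW r_gt0).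
  apply: ereal_sup_ubound; exists `I_n, (G \o t), (fun=> r); split=> //; split.
    by move=> i /tF[_ Ft]; rewrite r_gt0.
  exact: separated_disjoint.
have := le_lt_trans cont lt_content; rewrite -EFinD lte_fin => h.
rewrite lee_fin powRM ?(ltW r_gt0)// -/K.
have -> : n%:R * (C * (2 `^ s * r `^ s)) = K * (n%:R * r `^ s) by rewrite /K; ring.
have <- : K * (q + e / K) = K * q + e by field; rewrite gt_eqF.
by rewrite ler_pM2l// ltW.
Qed.

Lemma upper_mass_packing d (T : measurableType d) (R : realType)
    (mu : {measure set T -> \bar R}) (D : set T) (G : T -> R * R * R)
    (s C r0 s1 c r1 : R) :
  measurable D -> mu D = 1%E -> 0 <= s -> 0 < C -> 0 < r0 -> 0 < c -> 0 < r1 ->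
  upper_mass mu D G s C r0 -> lower_mass mu D G s1 c r1 ->
  packing_measure s (G @` D) <> 0%E.
Proof.
move=> mD muD s0 C0 r00 c0 r10 up low P0.
have K0 : 0 < C * 2 `^ s by rewrite mulr_gt0// powR_gt0.
have : (packing_measure s (G @` D) < ((C * 2 `^ s)^-1)%:E)%E.
  by rewrite P0 lte_fin invr_gt0.
move=> /ereal_inf_lt[_ [F cov <-]]; rewrite ltNge => /negP; apply.
have := cover_mass_le (mu := mu) mD (ltW K0)
  (fun n => packing_premeasure_ge0 s (F n)) cov.
rewrite muD => h; rewrite -[leLHS]mule1.
rewrite lee_pdivrMl//; apply: h => n e e0.
exact: (upper_mass_packing_premeasure _ mD muD s0 C0 r00 c0 r10 e0 up low).
Qed.

(** * Covering numbers and the box dimension *)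

Lemma upper_mass_covering d (T : measurableType d) (R : realType)
    (mu : {measure set T -> \bar R}) (D : set T) (G : T -> R * R * R)
    (s C r0 dlt : R) : measurable D -> mu D = 1%E -> 0 < C ->
  upper_mass mu D G s C r0 -> 0 < dlt <= r0 ->
  ((C^-1 * dlt `^ (- s))%:E <= covering_number dlt (G @` D))%E.
Proof.
move=> mD muD C0 up d01; apply: le_ereal_inf_tmp => _ [n [U [cov Ud]] <-].
have [E EE] := boolp.choice (fun i => upper_mass_diam (ltW C0) up d01 (Ud i)).
pose F k := if insub k is Some i then E i else set0.
have d0 : 0 < dlt by case/andP: d01.
have mF k : measurable (F k).
  by rewrite /F; case: insubP => // i _ _; have [] := EE i.
have DF : D `<=` \bigcup_(k in `I_n) F k.
  move=> t Dt; have [i _ Ui] : (\bigcup_i U i) (G t) by apply: cov; exists t.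
  by exists i => //=; rewrite /F valK; have [_ /(_ t Dt Ui)] := EE i.
have := measure_finite_cover (mu := mu) (c := C * dlt `^ s) mD mF DF.
rewrite muD lee_fin => h.
rewrite lee_fin powRN -invfM -[leLHS]mul1r ler_pdivrMr ?mulr_gt0 ?powR_gt0//.
apply: h => k; rewrite /F; case: insubP => [i _ _|_]; first by have [] := EE i.
by rewrite measure0 lee_fin mulr_ge0 ?powR_ge0// ltW.
Qed.

Lemma limf_esup_le (T : choiceType) (X : filteredType T) (R : realType)
    (f : X -> \bar R) (F : set (set X)) (y : \bar R) :
  F [set x | (f x <= y)%E] -> (limf_esup f F <= y)%E.
Proof.
move=> FV; rewrite limf_esupE.
apply: (@le_trans _ _ (ereal_sup (f @` [set x | (f x <= y)%E]))).
  by apply: ereal_inf_lbound; exists [set x | (f x <= y)%E].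
by apply: ge_ereal_sup => _ [x fx <-].
Qed.

Lemma limf_einf_ge (T : choiceType) (X : filteredType T) (R : realType)
    (f : X -> \bar R) (F : set (set X)) (y : \bar R) :
  F [set x | (y <= f x)%E] -> (y <= limf_einf f F)%E.
Proof.
move=> FV; rewrite limf_einfE.
apply: (@le_trans _ _ (ereal_inf (f @` [set x | (y <= f x)%E]))).
  by apply: le_ereal_inf_tmp => _ [x fx <-].
by apply: ereal_sup_ubound; exists [set x | (y <= f x)%E].
Qed.

Lemma limf_einf_le_esup (T : choiceType) (X : filteredType T) (R : realType)
    (f : X -> \bar R) (F : set (set X)) {FF : ProperFilter F} :
  (limf_einf f F <= limf_esup f F)%E.
Proof.
rewrite limf_einfE limf_esupE; apply: ge_ereal_sup => _ [V FV <-].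
apply: le_ereal_inf_tmp => _ [W FW <-].
have [x [Vx Wx]] := filter_ex (filterI FV FW).
apply: (@le_trans _ _ (f x)).
  by apply: ereal_inf_lbound; exists x.
by apply: ereal_sup_ubound; exists x.
Qed.

(** A constant factor [K] in a covering number contributes [ln K / - ln dlt] to the box ratio, and
    this tends to 0. *)
Lemma near_ln_small (R : realType) (K e d0 : R) : 0 < e -> 0 < d0 ->
  \forall dlt \near 0^'+,
    [/\ 0 < dlt, dlt <= d0, ln dlt < 0 & `|ln K| <= e * - ln dlt].
Proof.
move=> e0 d00.
have /cvgrNyPle/(_ (- (`|ln K| / e + 1))) := @lnNy R.
apply: filter_app; near=> dlt => h; split.
- by near: dlt; exact: nbhs_right_gt.
- by near: dlt; exact: nbhs_right_le.
- by rewrite (le_lt_trans h)// oppr_lt0 ltr_wpDl// divr_ge0// (ltW e0).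
- rewrite mulrC -ler_pdivrMr//.
  by rewrite (le_trans _ (_ : `|ln K| / e + 1 <= _))// ?lerDl// lerNr.
Unshelve. all: by end_near. Qed.

Lemma covering_number_ge0 (R : realType) (dlt : R) (A : set (R * R * R)) :
  (0 <= covering_number dlt A)%E.
Proof. by apply: le_ereal_inf_tmp => _ [n _ <-]; rewrite lee_fin. Qed.

Lemma ln_covering_bound (R : realType) (K s dlt : R) : 0 < K -> 0 < dlt ->
  ln (K * dlt `^ (- s)) = ln K + s * - ln dlt.
Proof.
by move=> K0 d0; rewrite lnM ?posrE ?powR_gt0// ln_powR mulNr mulrN.
Qed.

Lemma lower_mass_box_ratio d (T : measurableType d) (R : realType)
    (mu : {measure set T -> \bar R}) (D : set T) (G : T -> R * R * R)
    (s c r0 e : R) : measurable D -> mu D = 1%E -> 0 < c -> 0 < r0 ->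
  lower_mass mu D G s c r0 -> 0 < e ->
  \forall dlt \near 0^'+, (box_ratio (G @` D) dlt <= (s + e)%:E)%E.
Proof.
move=> mD muD c0 r00 low e0; have d00 : 0 < 4 * r0 by rewrite mulr_gt0.
apply: filterS (near_ln_small (4 `^ s / c) e0 d00) => dlt [dlt0 dlt1 ln0 lnK].
have K0 : 0 < 4 `^ s / c by rewrite divr_gt0// powR_gt0.
have d4 : 0 < dlt <= 4 * r0 by rewrite dlt0.
have [n [U [cov Ud _ nb]]] := finite_ball_cover mD muD c0 low d4.
have cn : (covering_number dlt (G @` D) <= (4 `^ s / c * dlt `^ (- s))%:E)%E.
  apply: (@le_trans _ _ (n%:R)%:E); last by rewrite lee_fin.
  apply: ereal_inf_lbound; exists n => //; exists (fun i : 'I_n => U i).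
  by split=> // x /cov[i /= ni Ux]; exists (Ordinal ni).
have Kd : 0 < 4 `^ s / c * dlt `^ (- s) by rewrite mulr_gt0// powR_gt0.
have : (lne (covering_number dlt (G @` D)) <= (ln (4 `^ s / c * dlt `^ (- s)))%:E)%E.
  rewrite -lne_EFin// lee_lne// in_itv/= leey ?covering_number_ge0//.
  by rewrite andbT lee_fin ltW.
have nl : 0 < - ln dlt by rewrite oppr_gt0.
move=> h; rewrite /box_ratio.
apply: (le_trans (lee_wpmul2r _ h)); first by rewrite lee_fin invr_ge0 ltW.
rewrite -EFinM lee_fin ln_covering_bound// ler_pdivrMr// mulrDl.
by rewrite addrC lerD2l (le_trans (ler_norm _)).
Qed.

Lemma upper_mass_box_ratio d (T : measurableType d) (R : realType)
    (mu : {measure set T -> \bar R}) (D : set T) (G : T -> R * R * R)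
    (s C r0 e : R) : measurable D -> mu D = 1%E -> 0 < C -> 0 < r0 ->
  upper_mass mu D G s C r0 -> 0 < e ->
  \forall dlt \near 0^'+, ((s - e)%:E <= box_ratio (G @` D) dlt)%E.
Proof.
move=> mD muD C0 r00 up e0.
apply: filterS (near_ln_small C^-1 e0 r00) => dlt [dlt0 dlt1 ln0 lnK].
have d1 : 0 < dlt <= r0 by rewrite dlt0.
have cn := upper_mass_covering mD muD C0 up d1.
have Kd : 0 < C^-1 * dlt `^ (- s) by rewrite mulr_gt0 ?invr_gt0// powR_gt0.
have : ((ln (C^-1 * dlt `^ (- s)))%:E <= lne (covering_number dlt (G @` D)))%E.
  rewrite -lne_EFin// lee_lne// in_itv/= leey ?covering_number_ge0//.
  by rewrite andbT lee_fin ltW.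
have nl : 0 < - ln dlt by rewrite oppr_gt0.
move=> h; rewrite /box_ratio.
apply: (le_trans _ (lee_wpmul2r _ h)); last by rewrite lee_fin invr_ge0 ltW.
rewrite -EFinM lee_fin ln_covering_bound ?invr_gt0// ler_pdivlMr// mulrBl.
rewrite addrC lerD2r lerNl (le_trans _ lnK)// -normrN ler_norm.
by [].
Qed.

Lemma has_dim_of_mass d (T : measurableType d) (R : realType)
    (mu : {measure set T -> \bar R}) (D : set T) (G : T -> R * R * R) (b : R)
    (dim : dimension) :
  measurable D -> mu D = 1%E -> 0 < b ->
  (forall s, b < s -> exists c r0, [/\ 0 < c, 0 < r0 & lower_mass mu D G s c r0]) ->
  (forall s, 0 <= s < b ->
     exists C r0, [/\ 0 < C, 0 < r0 & upper_mass mu D G s C r0]) ->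
  has_dim dim (G @` D) b.
Proof.
move=> mD muD b0 low up.
have dim_inf (m : R -> \bar R) : (forall s, b < s -> m s = 0%E) ->
    (forall s, 0 <= s < b -> m s <> 0%E) ->
    ereal_inf [set s%:E | s in [set s | 0 <= s /\ m s = 0%E]] = b%:E.
  move=> m0 mn0; apply/eqP; rewrite eq_le; apply/andP; split.
    apply/lee_addgt0Pr => e e0; apply: ereal_inf_lbound; exists (b + e) => //.
    by split; [rewrite addr_ge0// ltW|apply: m0; rewrite ltrDl].
  apply: le_ereal_inf_tmp => _ [s [s0 ms] <-]; rewrite lee_fin leNgt.
  by apply/negP => sb; apply: (mn0 s) => //; rewrite s0.
have mid s : b < s -> b < (b + s) / 2 < s by move=> bs; apply/andP; split; lra.
(* Any exponent above [b] would do: the packing case only needs finite separated families. *)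
have [c1 [r1 [c10 r10 low1]]] := low (b + 1) (ltac:(lra)).
case: dim => /=.
- apply: dim_inf => [s bs|s sb].
    have /andP[bm ms] := mid s bs; have [c [r0 [c0 r00 l]]] := low _ bm.
    by apply: (lower_mass_hausdorff mD muD c0 r00 l) => //; lra.
  have [C [r0 [C0 r00 u]]] := up s sb; have /andP[s0 _] := sb.
  exact: (upper_mass_hausdorff mD muD s0 C0 r00 u).
- have ub : (upper_box_dim (G @` D) <= b%:E)%E.
    apply/lee_addgt0Pr => e e0; apply: limf_esup_le.
    have e2 : 0 < e / 2 by rewrite divr_gt0.
    have [c [r0 [c0 r00 l]]] := low (b + e / 2) (ltac:(lra)).
    apply: filterS (lower_mass_box_ratio mD muD c0 r00 l e2) => dlt /=.
    by rewrite -addrA -splitr.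
  have lb : (b%:E <= lower_box_dim (G @` D))%E.
    apply/lee_subgt0Pr => e e0; apply: limf_einf_ge.
    (* The minimum with [b] keeps the exponent [b - e' / 2] nonnegative. *)
    pose e' := Num.min e b; have e'0 : 0 < e' by rewrite lt_min e0.
    have e2 : 0 < e' / 2 by rewrite divr_gt0.
    have e'b : e' <= b by rewrite ge_min lexx orbT.
    have e'e : e' <= e by rewrite ge_min lexx.
    have [|C [r0 [C0 r00 u]]] := up (b - e' / 2); first by apply/andP; split; lra.
    apply: filterS (upper_mass_box_ratio mD muD C0 r00 u e2) => dlt /=.
    by apply: le_trans; rewrite -EFinB lee_fin; lra.
  have lu : (lower_box_dim (G @` D) <= upper_box_dim (G @` D))%E.
    exact: limf_einf_le_esup.
  split; apply/eqP; rewrite eq_le; apply/andP; split => //.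
    exact: (le_trans lu ub).
  exact: (le_trans lb lu).
- apply: dim_inf => [s bs|s sb].
    have /andP[bm ms] := mid s bs; have [c [r0 [c0 r00 l]]] := low _ bm.
    by apply: (lower_mass_packing mD muD c0 r00 l) => //; lra.
  have [C [r0 [C0 r00 u]]] := up s sb; have /andP[s0 _] := sb.
  exact: (upper_mass_packing mD muD s0 C0 r00 c10 r10 u low1).
Qed.

(** * Perturbation of a continuous function *)

Definition dist1 (R : realType) (x y : R * R) : R :=
  `|x.1 - y.1| + `|x.2 - y.2|.

Lemma dist1_ge0 (R : realType) (x y : R * R) : 0 <= dist1 x y.
Proof. exact: addr_ge0. Qed.

Lemma dist1_triangle (R : realType) (y x z : R * R) :
  dist1 x z <= dist1 x y + dist1 y z.
Proof. by rewrite /dist1 addrACA lerD// ler_distD. Qed.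

Lemma dist1C (R : realType) (x y : R * R) : dist1 x y = dist1 y x.
Proof. by rewrite /dist1 distrC [X in _ + X]distrC. Qed.

Lemma dist1xx (R : realType) (x : R * R) : dist1 x x = 0.
Proof. by rewrite /dist1 !subrr normr0 addr0. Qed.

(** For close points continuity suffices, at the cost of [e]. For points at distance at least
    [d / 2], a large slope makes [L * dist1 x y] exceed [f x], while [f y] is nonnegative. *)
Lemma compact_approx_lipschitz (R : realType) (A : set (R * R))
    (f : R * R -> R) (e : R) :
  compact A -> cont_on A f -> (forall x, A x -> 0 <= f x) -> 0 < e ->
  exists2 L, 0 <= L & forall x y, A x -> A y -> f x <= f y + L * dist1 x y + e.
Proof.
move=> cA cf f0 e0.
pose P (L : R) (x : R * R) := A x -> forall y, A y -> f x <= f y + L * dist1 x y + e.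
have e2 : 0 < e / 2 by rewrite divr_gt0.
(* Compactness is used with [L] tending to infinity as a parameter: a neighbourhood and a threshold
   for [L] about each point are enough. *)
have /compact_near_coveringP/(_ R (pinfty_nbhs R) P _) := cA.
case=> [x Ax|M [_ hM]].
  have /subspace_continuousP/(_ x Ax)/cvgrPdist_le/(_ _ e2) := cf.
  rewrite near_withinE => /nbhs_ballP[d /= d0 near_x].
  have hd t : ball x d t -> A t -> `|f x - f t| <= e / 2 by exact: near_x.
  exists (ball x (d / 2), [set L | (f x + e) / (d / 2) < L]).
    split; first by apply: nbhsx_ballx; rewrite divr_gt0.
    by apply: nbhs_pinfty_gt; exact: num_real.
  move=> [x' L] /= [xx' hL] Ax' y Ay.
  have d2 : 0 < d / 2 by rewrite divr_gt0.
  have L0 : 0 <= L.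
    have fe : 0 <= f x + e by rewrite addr_ge0 ?f0// ltW.
    by rewrite (le_trans _ (ltW hL))// divr_ge0// ltW.
  have fxx' : `|f x - f x'| <= e / 2.
    by apply: hd => //; apply: le_ball xx'; lra.
  move: fxx'; rewrite ler_distlC => /andP[fx1 fx2].
  have [xy|nxy] := pselect (ball x d y).
    have := hd y xy Ay; rewrite ler_distlC => /andP[fy1 fy2].
    have := mulr_ge0 L0 (dist1_ge0 x' y); lra.
  have dxy : d / 2 <= dist1 x' y.
    rewrite leNgt; apply/negP => h; apply: nxy; case: xx' => x1 x2.
    have ballE (u v r : R) : ball u r v = (`|u - v| < r) :> Prop.
      by rewrite -ball_normE.
    move: h x1 x2; rewrite /dist1 !ballE => h x1 x2.
    have n1 := normr_ge0 (x'.1 - y.1); have n2 := normr_ge0 (x'.2 - y.2).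
    rewrite /ball /= /prod_ball !ballE; split.
      by rewrite (le_lt_trans (ler_distD x'.1 _ _))//; lra.
    by rewrite (le_lt_trans (ler_distD x'.2 _ _))//; lra.
  have Ld : f x + e <= L * dist1 x' y.
    rewrite (le_trans _ (_ : L * (d / 2) <= _))//.
      by rewrite -ler_pdivrMr// ltW.
    by rewrite ler_wpM2l.
  by have := f0 y Ay; lra.
exists (Num.max 0 (M + 1)); first by rewrite le_max lexx.
move=> x y Ax Ay; apply: (hM _ _ x Ax Ax y Ay).
by rewrite lt_max; apply/orP; right; lra.
Qed.

Lemma lipschitz_minorant (R : realType) (A : set (R * R))
    (f : R * R -> R) (e : R) : A !=set0 ->
  compact A -> cont_on A f -> (forall x, A x -> 0 <= f x) -> 0 < e ->
  exists L p, [/\ 0 <= L, forall x y, `|p x - p y| <= L * dist1 x y,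
    forall x, 0 <= p x & forall x, A x -> p x <= f x <= p x + e].
Proof.
move=> [a Aa] cA cf f0 e0.
have [L L0 hL] := compact_approx_lipschitz cA cf f0 e0.
(* The infimal convolution of f and L * dist1, which is nonnegative as f is. *)
pose S x := [set f y + L * dist1 x y | y in A].
have S0 x : S x !=set0 by exists (f a + L * dist1 x a), a.
have lb0 x : lbound (S x) 0.
  by move=> _ [y Ay <-]; rewrite addr_ge0 ?f0// mulr_ge0 ?dist1_ge0.
have Sle x y : A y -> inf (S x) <= f y + L * dist1 x y.
  by move=> Ay; apply: ge_inf; [exists 0; exact: lb0|exists y].
have lip x y : inf (S x) - inf (S y) <= L * dist1 x y.
  rewrite lerBlDr -lerBlDl; apply: lb_le_inf => // _ [z Az <-].
  rewrite lerBlDl (le_trans (Sle x z Az))// addrCA lerD2l -mulrDr.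
  by rewrite ler_wpM2l// dist1_triangle.
exists L, (fun x => inf (S x)); split=> // [x y|x|x Ax].
- by rewrite ler_norml lip andbT lerNl opprB dist1C lip.
- exact: lb_le_inf.
- rewrite (le_trans (Sle x x Ax)) ?dist1xx ?mulr0 ?addr0//=.
  rewrite -lerBlDr; apply: lb_le_inf => // _ [y Ay <-].
  by rewrite lerBlDr hL.
Qed.

Lemma lipschitz_continuous2 (R : realType) (p : R * R -> R) (L : R) :
  0 <= L -> (forall x y, `|p x - p y| <= L * dist1 x y) -> continuous p.
Proof.
move=> L0 lip x.
suff near_x (e : R) : 0 < e -> nbhs x [set y | `|p x - p y| <= e].
  by apply/cvgrPdist_le => e /near_x.
move=> e0.
have d0 : 0 < e / (2 * (L + 1)) by rewrite divr_gt0// mulr_gt0// ltr_wpDl.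
apply/nbhs_ballP; exists (e / (2 * (L + 1))) => //= y [y1 y2].
apply: (le_trans (lip _ _)).
have : dist1 x y <= e / (L + 1).
  have -> : e / (L + 1) = e / (2 * (L + 1)) + e / (2 * (L + 1)).
    by field; rewrite gt_eqF// ltr_wpDl.
  by rewrite lerD// ltW.
rewrite ler_pdivlMr ?ltr_wpDl// => h; rewrite (le_trans _ h)//.
by rewrite mulrC ler_wpM2l ?dist1_ge0// lerDl.
Qed.

(** * Transport of the mass to the graph *)

Definition unit_square (R : realType) : set (R * R) := `[0, 1] `*` `[0, 1].

Lemma powR_le_exponent (R : realType) (r s t : R) : 0 < r <= 1 -> s <= t ->
  r `^ t <= r `^ s.
Proof.
move=> /andP[r0 r1] st; rewrite /powR gt_eqF// ler_expR ler_wnM2r//.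
exact: ln_le0.
Qed.

Lemma zigzag_map_lower_mass (R : realType) (p : nat -> nat) (H M s : R)
    (G : R * R -> R * R * R) :
  (forall i, odd (p i)) -> 0 <= H <= 1 -> growth_rate H p -> 1 <= M ->
  (forall t t' r, `|t.1 - t'.1| <= r -> `|t.2 - t'.2| <= r ->
     `|zigzag p t.1 - zigzag p t'.1| <= r -> edist3 (G t) (G t') <= M * r) ->
  3 - H < s -> exists c r0, [/\ 0 < c, 0 < r0 &
    lower_mass (@lebesgue_measure R \x @lebesgue_measure R)%E
      (@unit_square R) G s c r0].
Proof.
move=> podd H01 grow M1 hG Hs.
pose dlt := Num.min 1 (s - (3 - H)).
have dlt01 : 0 < dlt <= 1 by rewrite lt_min ltr01 subr_gt0 Hs ge_min lexx.
have dlts : 3 - H + dlt <= s.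
  by rewrite -lerBrDl /dlt ge_min lexx orbT.
have [C C0 hC] := zigzag_ball_powR podd H01 grow dlt01.
have M0 : 0 < M by lra.
exists (C^-1 * M^-1 `^ (3 - H + dlt)), 1; split=> //.
  by rewrite mulr_gt0 ?invr_gt0// powR_gt0// invr_gt0.
move=> [u v] r [/= u01 v01] /andP[r0 r1]; pose rho := M^-1 * r.
have rho0 : 0 < rho by rewrite mulr_gt0 ?invr_gt0.
have rho1 : rho <= 1 by rewrite /rho mulrC ler_pdivrMr// mul1r (le_trans r1).
rewrite /= !in_itv/= in u01 v01; have /andP[v0 v1] := v01.
(* The image of [0, 1] under the contraction of ratio [rho] towards [v]: it has length [rho] and
   stays in [0, 1] even when [v] is an end point. *)
pose J := `[v - rho * v, v + rho * (1 - v)]%classic.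
have mZ := measurable_zigzag_ball podd u rho.
exists (zigzag_ball p u rho `*` J); split.
- by apply: measurableX => //; exact: measurable_itv.
- move=> [x y] [/= [x01 _] yJ]; split=> //=; move: yJ.
  rewrite /J/= !in_itv/= => /andP[y1 y2]; apply/andP; split.
    by rewrite (le_trans _ y1)// subr_ge0 ler_piMl.
  by rewrite (le_trans y2)// -lerBrDl ler_piMl// subr_ge0.
- move=> [x y] [/= [_ [ux zux]]]; rewrite /J/= in_itv/= => /andP[y1 y2].
  have -> : r = M * rho by rewrite /rho mulrA divff ?mul1r// gt_eqF.
  apply: hG => //=; rewrite ler_distlC.
  have h1 : 0 <= rho * v by rewrite mulr_ge0// ltW.
  have h2 : 0 <= rho * (1 - v) by rewrite mulr_ge0 ?(ltW rho0)// subr_ge0.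
  move: y1 y2 h1 h2; rewrite !mulrBr mulr1 => *; apply/andP; split; lra.
rewrite [leRHS]product_measure1E//; last exact: measurable_itv.
have rho01 : 0 < rho <= 1 by rewrite rho0.
have [_ hl] := hC rho u rho01 u01.
have mJ : lebesgue_measure J = rho%:E :> \bar R.
  rewrite lebesgue_measure_itv/= lte_fin ifT; last first.
    by rewrite -subr_gt0; have -> : v + rho * (1 - v) - (v - rho * v) = rho by ring.
  by rewrite -EFinB; congr (_%:E); ring.
rewrite [X in (_ * X)%E]mJ.
apply: (@le_trans _ _ ((C^-1 * rho `^ (2 - H + dlt))%:E * rho%:E)%E).
  rewrite -EFinM lee_fin -!mulrA ler_pM2l ?invr_gt0//.
  have -> : rho `^ (2 - H + dlt) * rho = rho `^ (3 - H + dlt).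
    have -> : 3 - H + dlt = 2 - H + dlt + 1 by ring.
    by rewrite [RHS]powRD ?(gt_eqF rho0) ?implybT// powRr1// ltW.
  rewrite [rho `^ _]powRM ?invr_ge0 ?(ltW M0) ?(ltW r0)//.
  rewrite ler_pM2l ?powR_gt0 ?invr_gt0//.
  by apply: powR_le_exponent; rewrite ?r0.
by apply: lee_wpmul2r => //; rewrite lee_fin ltW.
Qed.

Lemma zigzag_map_upper_mass (R : realType) (p : nat -> nat) (H N s : R)
    (G : R * R -> R * R * R) :
  (forall i, odd (p i)) -> 0 <= H <= 1 -> growth_rate H p -> 0 < N ->
  (forall t t' r, edist3 (G t) (G t') <= r -> [/\ `|t.1 - t'.1| <= N * r,
     `|t.2 - t'.2| <= N * r & `|zigzag p t.1 - zigzag p t'.1| <= N * r]) ->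
  s < 3 - H -> exists C r0, [/\ 0 < C, 0 < r0 &
    upper_mass (@lebesgue_measure R \x @lebesgue_measure R)%E
      (@unit_square R) G s C r0].
Proof.
move=> podd H01 grow N0 hG Hs.
pose dlt := Num.min 1 (3 - H - s).
have dlt01 : 0 < dlt <= 1 by rewrite lt_min ltr01 subr_gt0 Hs ge_min lexx.
have dlts : s <= 3 - H - dlt.
  by rewrite lerBrDr -lerBrDl /dlt ge_min lexx orbT.
have [C C0 hC] := zigzag_ball_powR podd H01 grow dlt01.
(* This bound on the radius makes both [r] and [N * r] at most 1. *)
exists (2 * C * N `^ (3 - H - dlt)), (1 + N)^-1; split.
- by rewrite !mulr_gt0// powR_gt0.
- by rewrite invr_gt0 addr_gt0.
move=> [u v] r [/= u01 v01] /andP[r0 r1]; pose rho := N * r.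
rewrite /= !in_itv/= in u01 v01.
have N10 : 0 < 1 + N by rewrite addr_gt0.
have rN : r * (1 + N) <= 1 by rewrite -ler_pdivlMr// div1r.
have rho0 : 0 < rho by rewrite mulr_gt0.
have rho1 : rho <= 1 by move: rN; rewrite /rho mulrDr mulr1 mulrC; lra.
have r_le1 : r <= 1 by move: rN; rewrite mulrDr mulr1; have := mulr_gt0 r0 N0; lra.
pose J := `[v - rho, v + rho]%classic.
have mZ := measurable_zigzag_ball podd u rho.
exists (zigzag_ball p u rho `*` J); split.
- by apply: measurableX => //; exact: measurable_itv.
- move=> [x y] [/= x01 _] /hG[/= h1 h2 h3]; split=> //=.
  by rewrite /J/= in_itv/= -ler_distlC.
rewrite [leLHS]product_measure1E//; last exact: measurable_itv.
have rho01 : 0 < rho <= 1 by rewrite rho0.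
have [hu _] := hC rho u rho01 u01.
have mJ : lebesgue_measure J = (2 * rho)%:E :> \bar R.
  rewrite lebesgue_measure_itv/= lte_fin ifT; last lra.
  by rewrite -EFinB; congr (_%:E); ring.
rewrite [X in (_ * X)%E]mJ.
apply: (@le_trans _ _ ((C * rho `^ (2 - H - dlt))%:E * (2 * rho)%:E)%E).
  by apply: lee_wpmul2r => //; rewrite lee_fin mulr_ge0// ltW.
rewrite -EFinM lee_fin.
have -> : C * rho `^ (2 - H - dlt) * (2 * rho) = 2 * C * rho `^ (3 - H - dlt).
  have -> : 3 - H - dlt = 2 - H - dlt + 1 by ring.
  rewrite [rho `^ (_ + 1)]powRD ?(gt_eqF rho0) ?implybT//.
  by rewrite powRr1 ?(ltW rho0)//; ring.
rewrite powRM ?(ltW N0) ?(ltW r0)// !mulrA ler_pM2l; last first.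
  by rewrite !mulr_gt0// powR_gt0.
by apply: powR_le_exponent; rewrite ?r0.
Qed.

(** The last two hypotheses say that [G t] is a bi-Lipschitz function of the triple
    [(t.1, t.2, zigzag p t.1)]. *)
Lemma has_dim_zigzag_map (R : realType) (dim : dimension) (p : nat -> nat)
    (H M N : R) (G : R * R -> R * R * R) :
  (forall i, odd (p i)) -> 0 <= H <= 1 -> growth_rate H p -> 1 <= M -> 0 < N ->
  (forall t t' r, `|t.1 - t'.1| <= r -> `|t.2 - t'.2| <= r ->
     `|zigzag p t.1 - zigzag p t'.1| <= r -> edist3 (G t) (G t') <= M * r) ->
  (forall t t' r, edist3 (G t) (G t') <= r -> [/\ `|t.1 - t'.1| <= N * r,
     `|t.2 - t'.2| <= N * r & `|zigzag p t.1 - zigzag p t'.1| <= N * r]) ->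
  has_dim dim (G @` @unit_square R) (3 - H).
Proof.
move=> podd H01 grow M1 N0 hM hN.
apply: (has_dim_of_mass dim (mu := (@lebesgue_measure R \x @lebesgue_measure R)%E)).
- by apply: measurableX => //; exact: measurable_itv.
- rewrite /unit_square [LHS]product_measure1E//.
  have m1 : lebesgue_measure (`[0, 1]%classic : set R) = 1%E.
    by rewrite lebesgue_measure_itv/= lte_fin ltr01 -EFinB subr0.
  by rewrite [X in (X * _)%E]m1 [X in (_ * X)%E]m1 mule1.
- by case/andP: H01 => *; lra.
- by move=> s; exact: (zigzag_map_lower_mass podd H01 grow M1 hM).
- by move=> s /andP[_]; exact: (zigzag_map_upper_mass podd H01 grow N0 hN).
Qed.

Definition rect_point (R : realType) (a b c d : R) (t : R * R) : R * R :=
  (a + (b - a) * t.1, c + (d - c) * t.2).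

Lemma rect_point_image (R : realType) (a b c d : R) : a < b -> c < d ->
  rect_point a b c d @` @unit_square R = rectangle a b c d.
Proof.
move=> ab cd; have ba0 : 0 < b - a by rewrite subr_gt0.
have dc0 : 0 < d - c by rewrite subr_gt0.
apply/seteqP; split=> [_ [[u v] [/= u01 v01] <-]|[x y] [/= xab ycd]].
  move: u01 v01; rewrite !in_itv/= => /andP[u0 u1] /andP[v0 v1].
  split; rewrite /= in_itv/=; apply/andP; split.
  - by rewrite lerDl mulr_ge0// ltW.
  - by rewrite -lerBrDl ler_piMr// ltW.
  - by rewrite lerDl mulr_ge0// ltW.
  - by rewrite -lerBrDl ler_piMr// ltW.
move: xab ycd; rewrite !in_itv/= => /andP[xa xb] /andP[yc yd].
exists ((x - a) / (b - a), (y - c) / (d - c)).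
  split; rewrite /= in_itv/= divr_ge0 ?subr_ge0 ?(ltW ab) ?(ltW cd)//=.
    by rewrite ler_pdivrMr// mul1r lerD2r.
  by rewrite ler_pdivrMr// mul1r lerD2r.
by rewrite /rect_point/=; congr pair; field; rewrite gt_eqF.
Qed.

Definition zigzag_sum (R : realType) (p : nat -> nat) (eta a b : R)
    (q : R * R -> R) (x : R * R) : R :=
  q x + eta * zigzag p ((x.1 - a) / (b - a)).

Lemma zigzag_sum_continuous (R : realType) (p : nat -> nat) (eta a b L : R)
    (q : R * R -> R) : (forall i, odd (p i)) -> 0 <= L ->
  (forall x y, `|q x - q y| <= L * dist1 x y) ->
  continuous (zigzag_sum p eta a b q).
Proof.
move=> podd L0 lip x; apply: cvgD; first exact: (lipschitz_continuous2 L0 lip).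
apply: cvgMr; apply: continuous_comp; last exact: zigzag_continuous.
by apply: cvgMl; apply: cvgB; [exact: cvg_fst|exact: cvg_cst].
Qed.

Lemma has_dim_zigzag_sum (R : realType) (dim : dimension) (p : nat -> nat)
    (a b c d H eta L : R) (q : R * R -> R) :
  a < b -> c < d -> (forall i, odd (p i)) -> 0 <= H <= 1 -> growth_rate H p ->
  0 < eta -> 0 <= L -> (forall x y, `|q x - q y| <= L * dist1 x y) ->
  has_dim dim (graph_on (rectangle a b c d) (zigzag_sum p eta a b q)) (3 - H).
Proof.
move=> ab cd podd H01 grow eta0 L0 lip.
have ba0 : 0 < b - a by rewrite subr_gt0.
have dc0 : 0 < d - c by rewrite subr_gt0.
pose G t := (rect_point a b c d t, q (rect_point a b c d t) + eta * zigzag p t.1).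
have -> : graph_on (rectangle a b c d) (zigzag_sum p eta a b q) = G @` @unit_square R.
  rewrite -rect_point_image// /graph_on image_comp; congr image.
  apply/funext => -[u v] /=; rewrite /G /zigzag_sum /rect_point/=.
  have -> // : (a + (b - a) * u - a) / (b - a) = u.
  by field; rewrite gt_eqF.
pose w := (b - a) + (d - c).
have w0 : 0 < w by rewrite addr_gt0.
have dx t t' : `|(G t).1.1 - (G t').1.1| = (b - a) * `|t.1 - t'.1|.
  by rewrite /= opprD addrACA subrr add0r -mulrBr normrM gtr0_norm.
have dy t t' : `|(G t).1.2 - (G t').1.2| = (d - c) * `|t.2 - t'.2|.
  by rewrite /= opprD addrACA subrr add0r -mulrBr normrM gtr0_norm.
have dq t t' : `|q (G t).1 - q (G t').1|
    <= L * ((b - a) * `|t.1 - t'.1| + (d - c) * `|t.2 - t'.2|).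
  by rewrite (le_trans (lip _ _))// /dist1 dx dy.
have dz t t' : `|((G t).2 - (G t').2) - (q (G t).1 - q (G t').1)|
    = eta * `|zigzag p t.1 - zigzag p t'.1|.
  have -> : (G t).2 - (G t').2 - (q (G t).1 - q (G t').1)
    = eta * (zigzag p t.1 - zigzag p t'.1) by rewrite /G/=; ring.
  by rewrite normrM gtr0_norm.
(* In the first constant, 2 comes from [edist3_le_coord] and the summand 1 makes it at least 1. In
   the second, [(1 + 2 * L) / eta] bounds the zigzag: a height difference [r] is corrected by at
   most [2 * L * r] for [q]. *)
apply: (@has_dim_zigzag_map R dim p H (1 + 2 * (w + L * w + eta))
  ((b - a)^-1 + (d - c)^-1 + (1 + 2 * L) / eta)) => //.
- have := mulr_ge0 L0 (ltW w0); lra.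
- have L1 : 0 < 1 + 2 * L by lra.
  have ib : 0 < (b - a)^-1 by rewrite invr_gt0.
  have ic : 0 < (d - c)^-1 by rewrite invr_gt0.
  have := divr_gt0 L1 eta0; lra.
- move=> t t' r h1 h2 h3; have r0 : 0 <= r by rewrite (le_trans _ h1).
  have ewr : 0 <= w * r by rewrite mulr_ge0// ltW.
  have eLr : 0 <= L * (w * r) by rewrite mulr_ge0.
  have eer : 0 <= eta * r by rewrite mulr_ge0// ltW.
  have b1 : (b - a) * `|t.1 - t'.1| <= (b - a) * r by rewrite ler_pM2l.
  have b2 : (d - c) * `|t.2 - t'.2| <= (d - c) * r by rewrite ler_pM2l.
  have b3 : eta * `|zigzag p t.1 - zigzag p t'.1| <= eta * r by rewrite ler_pM2l.
  have c1 : 0 <= (b - a) * r by rewrite mulr_ge0// ltW.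
  have c2 : 0 <= (d - c) * r by rewrite mulr_ge0// ltW.
  have wr : w * r = (b - a) * r + (d - c) * r by rewrite /w mulrDl.
  have E : (w + L * w + eta) * r = w * r + L * (w * r) + eta * r by ring.
  apply: (@le_trans _ _ (2 * ((w + L * w + eta) * r))); last first.
    by rewrite mulrA ler_wpM2r// lerDr.
  rewrite E; apply: edist3_le_coord.
  - by rewrite dx; lra.
  - by rewrite dy; lra.
  - rewrite -(subrK (q (G t).1 - q (G t').1) (_ - _)).
    rewrite (le_trans (ler_normD _ _))// dz.
    have : L * ((b - a) * `|t.1 - t'.1| + (d - c) * `|t.2 - t'.2|) <= L * (w * r).
      by rewrite ler_wpM2l//; lra.
    by have := dq t t'; lra.
- move=> t t' r tr; have [] := edist3_coord (G t) (G t').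
  rewrite dx dy => k1 k2 k3.
  have r0 : 0 <= r by rewrite (le_trans _ tr)// edist3_ge0.
  have m1 : (b - a) * `|t.1 - t'.1| <= r by rewrite (le_trans k1).
  have m2 : (d - c) * `|t.2 - t'.2| <= r by rewrite (le_trans k2).
  have m3 : eta * `|zigzag p t.1 - zigzag p t'.1| <= (1 + 2 * L) * r.
    rewrite -dz (le_trans (ler_normB _ _))//.
    have : L * ((b - a) * `|t.1 - t'.1| + (d - c) * `|t.2 - t'.2|) <= L * (r + r).
      by rewrite ler_wpM2l// lerD.
    by have := dq t t'; have := le_trans k3 tr; lra.
  have i1 : 0 <= (b - a)^-1 * r by rewrite mulr_ge0// invr_ge0 ltW.
  have i2 : 0 <= (d - c)^-1 * r by rewrite mulr_ge0// invr_ge0 ltW.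
  have i3 : 0 <= (1 + 2 * L) / eta * r.
    by rewrite mulr_ge0// divr_ge0 ?(ltW eta0)// addr_ge0// mulr_ge0.
  rewrite !mulrDl; split.
  - rewrite (le_trans (_ : _ <= (b - a)^-1 * r))//; last lra.
    by rewrite ler_pdivlMl.
  - rewrite (le_trans (_ : _ <= (d - c)^-1 * r))//; last lra.
    by rewrite ler_pdivlMl.
  - rewrite (le_trans (_ : _ <= (1 + 2 * L) / eta * r))//; last lra.
    by rewrite mulrAC ler_pdivlMr// mulrC.
Qed.

Theorem theorem2p7 (R : realType) (dim : dimension) (a b c d : R)
    (hab : a < b) (hcd : c < d) (beta : R) (hbeta : 2 <= beta <= 3)
    (f : R * R -> R) (hf : cont_on (rectangle a b c d) f)
    (hf0 : forall x, rectangle a b c d x -> 0 <= f x)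
    (eps : R) (heps : 0 < eps) :
  exists g : R * R -> R,
    [/\ S_dim dim (rectangle a b c d) beta g,
        (forall x, rectangle a b c d x -> 0 <= g x) &
        sup_norm (rectangle a b c d) (f \- g) < eps].
Proof.
have H01 : 0 <= 3 - beta <= 1 by case/andP: hbeta => *; apply/andP; split; lra.
have [p podd grow] := growth_rate_exists H01.
have rect0 : rectangle a b c d (a, c).
  by split; rewrite /= in_itv/= lexx ltW.
have rectK : compact (rectangle a b c d).
  by apply: compact_setX; exact: segment_compact.
have e4 : 0 < eps / 4 by rewrite divr_gt0.
have [L [q [L0 lip q0 qf]]] :=
  lipschitz_minorant (ex_intro _ _ rect0) rectK hf hf0 e4.
(* The zigzag reaches at most 2, so it uses up [eps / 4], as does the minorant. The two errors have
   opposite signs. *)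
have e8 : 0 < eps / 8 by rewrite divr_gt0.
have zz x : rectangle a b c d x ->
    0 <= eps / 8 * zigzag p ((x.1 - a) / (b - a)) <= eps / 4.
  move=> [/= + _]; rewrite in_itv/= => /andP[xa xb].
  have x1 : (x.1 - a) / (b - a) <= 1.
    by rewrite ler_pdivrMr ?subr_gt0// mul1r lerD2r.
  have /andP[z0 z2] := zigzag_range podd x1.
  rewrite mulr_ge0 ?(ltW e8)//=.
  have -> : eps / 4 = eps / 8 * 2 by field.
  by rewrite ler_pM2l.
exists (zigzag_sum p (eps / 8) a b q); split.
- split.
    by apply: continuous_subspaceT; exact: (zigzag_sum_continuous podd L0 lip).
  have -> : beta = 3 - (3 - beta) by ring.
  exact: (has_dim_zigzag_sum dim hab hcd podd H01 grow e8 L0 lip).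
- by move=> x /zz/andP[z0 _]; rewrite addr_ge0.
- apply: (@le_lt_trans _ _ (eps / 2)); last by lra.
  apply: ge_sup.
    by exists `|(f \- zigzag_sum p (eps / 8) a b q) (a, c)|, (a, c).
  move=> _ [x Rx <-] /=.
  have /andP[z0 z1] := zz x Rx; have /andP[q1 q2] := qf x Rx.
  by rewrite /zigzag_sum ler_norml; apply/andP; split; lra.
Qed.
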